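(* Let $v_1,\dots,v_n$ be linearly independent vectors of $\mathbb{R}^n$, and let $$\Lambda_{v_1,\dots,v_n}=\Big\{x\in\mathbb{R}^n:\ x=\sum_{i=1}^n x_i v_i,\ x_i>0 \text{ for all } i\Big\}.$$ Then there exists a constant $c>0$, depending only on the choice of the vectors $v_i$, such that $$E_k(x,gy)\le c\,\frac{e^{\langle x,y\rangle}}{\sqrt{w_k(x)\,w_k(y)}}$$ for all $x,y\in\Lambda_{v_1,\dots,v_n}$ and all $g\in G$.
   Context: Let $R$ be a reduced root system in $\mathbb{R}^n$ spanning $\mathbb{R}^n$, $R^+$ a positive subsystem, and $G\subset O(\mathbb{R}^n)$ the finite reflection group generated by the reflections $\sigma_\alpha$, $\alpha\in R$, where $\sigma_\alpha$ is the orthogonal reflection in the hyperplane orthogonal to $\alpha$. $\langle\cdot,\cdot\rangle$ is the Euclidean inner product (extended bilinearly to $\mathbb{C}^n$). Let $k:R\to[0,+\infty)$ be a $G$-invariant function (multiplicity function), and $\gamma_k=\sum_{\alpha\in R^+}k(\alpha)$, assumed $>0$. The weight is $w_k(x)=\prod_{\alpha\in R^+}|\langle\alpha,x\rangle|^{2k(\alpha)}$. The Dunkl operators are, for $\xi\in\mathbb{R}^n$, $$D_\xi^kf(x)=\partial_\xi f(x)+\sum_{\alpha\in R^+}k(\alpha)\langle\alpha,\xi\rangle\frac{f(x)-f(\sigma_\alpha x)}{\langle\alpha,x\rangle},$$ where $\partial_\xi$ is the directional derivative. For $y\in\mathbb{C}^n$, the Dunkl kernel $x\mapsto E_k(x,y)$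 is the unique real-analytic solution on $\mathbb{R}^n$ of $D_\xi^kf=\langle y,\xi\rangle f$ for all $\xi\in\mathbb{R}^n$ with $f(0)=1$; $E_k$ extends to a holomorphic function on $\mathbb{C}^n\times\mathbb{C}^n$.
   Formalization: The formal theorem additionally assumes that the cone Λ meets no reflecting hyperplane of R (so it lies in a single Weyl chamber); without this the claim is false, e.g. R={±e1,±e2}, v1=(1,1), v2=(-1,1). *)

(* Defs.v *)
(* Mathematical Components + MathComp-Analysis. *)
From HB Require Import structures.
From mathcomp Require Import all_boot all_order all_algebra finmap.
From mathcomp Require Import complex.
From mathcomp Require Import all_classical all_reals all_analysis.
Set Implicit Arguments.
Unset Strict Implicit.
Unset Printing Implicit Defensive.
Import Order.TTheory GRing.Theory Num.Theory.
Import numFieldNormedType.Exports.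
Local Open Scope classical_set_scope.
Local Open Scope ring_scope.
Local Open Scope complex_scope.
Local Open Scope fset_scope.

(* Bilinear, also over R[i] (no conjugation). *)
Definition dot (K : pzRingType) (n : nat) (x y : 'rV[K]_n) : K :=
  \sum_(i < n) x 0 i * y 0 i.

Definition real_row (R : realType) (n : nat) (x : 'rV[R]_n) : 'rV[R[i]]_n :=
  map_mx (real_complex R) x.

Definition refl (R : realType) (n : nat) (a x : 'rV[R]_n) : 'rV[R]_n :=
  x - (2 * dot a x / dot a a) *: a.

Record reduced_root_system (R : realType) (n : nat) (Phi : {fset 'rV[R]_n}) :
    Prop := {
  root_neq0 : forall a, a \in Phi -> a != 0;
  root_refl : forall a b, a \in Phi -> b \in Phi -> refl a b \in Phi;
  root_reduced : forall a (c : R), a \in Phi -> c *: a \in Phi ->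
    c = 1 \/ c = -1
}.

Definition spanning (R : realType) (n : nat) (Phi : {fset 'rV[R]_n}) : Prop :=
  (<<enum_fset Phi>> = fullv)%VS.

Definition positive_subsystem (R : realType) (n : nat)
    (Phi Phip : {fset 'rV[R]_n}) : Prop :=
  exists2 b : 'rV[R]_n,
    (forall a, a \in Phi -> dot a b != 0) &
    Phip = [fset a in Phi | 0 < dot a b].

(* The reflections are involutions, so that their finite products already form
   the group which they generate. *)
Inductive refl_group (R : realType) (n : nat) (Phi : {fset 'rV[R]_n}) :
    ('rV[R]_n -> 'rV[R]_n) -> Prop :=
| refl_group_id : refl_group Phi id
| refl_group_comp a g :
    a \in Phi -> refl_group Phi g -> refl_group Phi (refl a \o g).

(* Only the values of k on Phi matter. *)
Record multiplicity_function (R : realType) (n : nat) (Phi : {fset 'rV[R]_n})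
    (k : 'rV[R]_n -> R) : Prop := {
  mult_ge0 : forall a, a \in Phi -> 0 <= k a;
  mult_inv : forall g a, refl_group Phi g -> a \in Phi -> k (g a) = k a
}.

Definition gamma (R : realType) (n : nat) (Phip : {fset 'rV[R]_n})
    (k : 'rV[R]_n -> R) : R :=
  \sum_(a <- Phip) k a.

(* A factor with k a = 0 equals 1, also where <a, x> = 0. *)
Definition weight (R : realType) (n : nat) (Phip : {fset 'rV[R]_n})
    (k : 'rV[R]_n -> R) (x : 'rV[R]_n) : R :=
  \prod_(a <- Phip) (`|dot a x| `^ (2 * k a)).

(* On the hyperplane <a, x> = 0 the difference quotient is extended by its
   limit: since x - refl a x = (2 <a, x> / <a, a>) a, this limit is
   (2 / <a, a>) times the derivative of f along a. *)
Definition refl_quotient (R : realType) (n : nat) (f : 'rV[R]_n -> R)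
    (a x : 'rV[R]_n) : R :=
  if dot a x == 0 then 2 / dot a a * 'D_a f x
  else (f x - f (refl a x)) / dot a x.

Definition dunkl_op (R : realType) (n : nat) (Phip : {fset 'rV[R]_n})
    (k : 'rV[R]_n -> R) (xi : 'rV[R]_n) (f : 'rV[R]_n -> R)
    (x : 'rV[R]_n) : R :=
  'D_xi f x + \sum_(a <- Phip) k a * dot a xi * refl_quotient f a x.

(* The real operator acts on the real and imaginary parts. *)
Definition dunkl_opC (R : realType) (n : nat) (Phip : {fset 'rV[R]_n})
    (k : 'rV[R]_n -> R) (xi : 'rV[R]_n) (f : 'rV[R]_n -> R[i])
    (x : 'rV[R]_n) : R[i] :=
  dunkl_op Phip k xi (fun z => complex.Re (f z)) x
  +i* dunkl_op Phip k xi (fun z => complex.Im (f z)) x.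

Definition monomial (R : realType) (n : nat) (m : {ffun 'I_n -> nat})
    (h : 'rV[R]_n) : R :=
  \prod_(i < n) h 0 i ^+ m i.

(* Around every point, f is the sum of an absolutely convergent power series in
   n variables; the sum of the absolutely summable family is the sum of its
   positive part minus the sum of its negative part. *)
Definition real_analytic (R : realType) (n : nat) (f : 'rV[R]_n -> R) : Prop :=
  forall x : 'rV[R]_n, exists (r : R) (c : {ffun 'I_n -> nat} -> R),
    0 < r /\
    forall h : 'rV[R]_n, (forall i, `|h 0 i| < r) ->
      let term := fun m : {ffun 'I_n -> nat} => (c m * monomial m h)%:E in
      summable [set: {ffun 'I_n -> nat}] term /\
      ((f (x + h)%R)%:E =
        \esum_(m in [set: {ffun 'I_n -> nat}]) (term^\+ m)%E
        - \esum_(m in [set: {ffun 'I_n -> nat}]) (term^\- m)%E)%E.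

(* E x y is the Dunkl kernel for x in R^n and y in C^n; these conditions
   determine it uniquely. *)
Record dunkl_kernel (R : realType) (n : nat) (Phip : {fset 'rV[R]_n})
    (k : 'rV[R]_n -> R) (E : 'rV[R]_n -> 'rV[R[i]]_n -> R[i]) : Prop := {
  kernel_analytic_Re : forall y, real_analytic (fun x => complex.Re (E x y));
  kernel_analytic_Im : forall y, real_analytic (fun x => complex.Im (E x y));
  kernel_eigen : forall y xi x,
    dunkl_opC Phip k xi (E ^~ y) x = dot y (real_row xi) * E x y;
  kernel_at0 : forall y, E 0 y = 1
}.

Definition open_cone (R : realType) (n : nat) (v : n.-tuple 'rV[R]_n) :
    set 'rV[R]_n :=
  [set x | exists2 t : 'I_n -> R,
    (forall i, 0 < t i) & x = \sum_(i < n) t i *: tnth v i].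

(* The complement of the reflecting hyperplanes.  A convex subset of it is a
   subset of a single Weyl chamber. *)
Definition regular_set (R : realType) (n : nat) (Phi : {fset 'rV[R]_n}) :
    set 'rV[R]_n :=
  [set x | forall a, a \in Phi -> dot a x != 0].

(* Main.v *)
Require Import Defs.
From HB Require Import structures.
From mathcomp Require Import all_boot all_order all_algebra finmap.
From mathcomp Require Import complex.
From mathcomp Require Import all_classical all_reals all_analysis.
From mathcomp Require Import ring lra.
Import Order.TTheory GRing.Theory Num.Theory.
Import numFieldNormedType.Exports.
Local Open Scope classical_set_scope.
Local Open Scope ring_scope.
Local Open Scope complex_scope.

Set Implicit Arguments.
Unset Strict Implicit.
Unset Printing Implicit Defensive.

(** Write [e x y] for the real part of [E x y] at real [y], and normalize it to
    [N x y = sqrt (w x * w y) * exp (- <x, y>) * e x y].  The claim is that on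
    a chamber [N] is bounded, also with [e x (g y)] in place of [e x y].

    Along the ray [t x] the kernel at the points of an orbit solves the finite
    linear system
      [t e'(t z) = (t <y, z> - gam) e(t z) + sum_a kap_a e(t (refl a z))],
    whose coupling coefficients are nonnegative.  A maximum principle
    ([max_principle]) then gives uniqueness, positivity and
    [e <= exp (max <y, .>)].  From uniqueness follow the invariance
    [e (g x) (g y) = e x y] and, because [t |-> e (t y) z] solves the same
    system with [z] as the index, the symmetry [e x y = e y x]
    ([kernel_sym]).

    The main point is that [N] is monotone ([nkernel_mono]): its derivative in
    a direction [xi] of the chamber is
      [sum_a kap_a <a, xi> / <a, x> * e (refl a x) y]
    up to a positive factor, with nonnegative terms.  By symmetry [N] increases
    in both arguments, so that it is bounded on the chamber as soon as it is
    bounded at [(T p, T p)] for one fixed point [p] and all large [T]; there an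
    explicit supersolution applies, because [p] is the strict maximum of
    [<p, .>] on its orbit ([ray_bound], [wall_pos_bound]).

    It remains to treat [E x (g y)], that is [e z x] with [z] in the orbit of
    [y].  At a maximum over time and orbit the loss [<x, y - z>] is at most
    [gam].  While the loss is bounded, a Harnack inequality on the ray
    ([harnack_step]) compares [z] with its reflection in a violated wall of
    positive multiplicity, and a bounded number of such reflections leads to a
    point on the same side as [x] of all those walls, where the first part
    applies ([chain_bound], [orbit_bound]).  This uses that the loss is
    nonnegative, [<x, g y> <= <x, y>] for [x] and [y] in one chamber
    ([chamber_max]), a fact of the theory of reflection groups that is proved
    here from the exchange property of words in simple reflections. *)

Lemma count_lt (T : eqType) (a1 a2 : pred T) (s : seq T) x :
  subpred a1 a2 -> x \in s -> a2 x -> ~~ a1 x -> (count a1 s < count a2 s)%N.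
Proof.
move=> sub xs a2x a1x; elim: s xs => //= y s IH; rewrite inE => /orP[/eqP <-|xs].
  by rewrite (negPf a1x) a2x ltnS sub_count.
by rewrite -addnS leq_add ?IH //; case: (a1 y) (sub y) => // ->.
Qed.

(** * The inner product and the reflections *)

Section Euclid.
Context {R : realType} {n : nat}.
Implicit Types (x y z a b : 'rV[R]_n) (c t : R).

Lemma dotC x y : dot x y = dot y x.
Proof. by apply: eq_bigr => i _; rewrite mulrC. Qed.

Lemma dotDl x y z : dot (x + y) z = dot x z + dot y z.
Proof. by rewrite /dot -big_split; apply: eq_bigr => i _; rewrite mxE mulrDl. Qed.

Lemma dotZl c x y : dot (c *: x) y = c * dot x y.
Proof. by rewrite /dot mulr_sumr; apply: eq_bigr => i _; rewrite mxE mulrA. Qed.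

Lemma dotDr x y z : dot x (y + z) = dot x y + dot x z.
Proof. by rewrite dotC dotDl !(dotC _ x). Qed.

Lemma dotZr c x y : dot x (c *: y) = c * dot x y.
Proof. by rewrite dotC dotZl dotC. Qed.

Lemma dotNl x y : dot (- x) y = - dot x y.
Proof. by rewrite -scaleN1r dotZl mulN1r. Qed.

Lemma dotNr x y : dot x (- y) = - dot x y.
Proof. by rewrite dotC dotNl dotC. Qed.

Lemma dotBl x y z : dot (x - y) z = dot x z - dot y z.
Proof. by rewrite dotDl dotNl. Qed.

Lemma dotBr x y z : dot x (y - z) = dot x y - dot x z.
Proof. by rewrite dotDr dotNr. Qed.

Lemma dot0r x : dot x 0 = 0.
Proof. by rewrite -(scale0r (0 : 'rV_n)) dotZr mul0r. Qed.

Lemma dot_ge0 x : 0 <= dot x x.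
Proof. by apply: sumr_ge0 => i _; rewrite -expr2 sqr_ge0. Qed.

Lemma dot_eq0 x : (dot x x == 0) = (x == 0).
Proof.
apply/idP/eqP => [|->]; last by rewrite dot0r.
rewrite psumr_eq0; last by move=> i _; rewrite -expr2 sqr_ge0.
move=> /allP h; apply/rowP => i; rewrite mxE; apply/eqP.
by have := h i (mem_index_enum _); rewrite mulf_eq0 orbb.
Qed.

Lemma dot_gt0 x : (0 < dot x x) = (x != 0).
Proof. by rewrite lt_neqAle dot_ge0 andbT eq_sym dot_eq0. Qed.

Lemma dot_lt_eqnorm x y : dot x x = dot y y -> x != y -> dot x y < dot x x.
Proof.
move=> e; rewrite -subr_eq0 -dot_gt0 dotBl !dotBr -e (dotC y x) => h.
lra.
Qed.

Lemma dot_refl a x y : dot (refl a x) y = dot x (refl a y).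
Proof. by rewrite /refl dotBl dotBr dotZl dotZr (dotC x a); ring. Qed.

Lemma dot_reflE a x y : dot x (refl a y) = dot x y - 2 * dot a y / dot a a * dot a x.
Proof. by rewrite /refl dotBr dotZr (dotC x a). Qed.

Lemma reflD a x y : refl a (x + y) = refl a x + refl a y.
Proof. by rewrite /refl dotDr mulrDr mulrDl scalerDl opprD addrACA. Qed.

Lemma reflZ a c x : refl a (c *: x) = c *: refl a x.
Proof. by rewrite /refl dotZr scalerBr scalerA; congr (_ - _ *: _); ring. Qed.

Lemma reflN a x : refl a (- x) = - refl a x.
Proof. by rewrite -scaleN1r reflZ scaleN1r. Qed.

Lemma reflB a x y : refl a (x - y) = refl a x - refl a y.
Proof. by rewrite reflD reflN. Qed.

Lemma refl_fix a x : dot a x = 0 -> refl a x = x.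
Proof. by rewrite /refl => ->; rewrite mulr0 mul0r scale0r subr0. Qed.

Lemma refl_opp a x : refl (- a) x = refl a x.
Proof. by rewrite /refl !(dotNl, dotNr) opprK mulrN mulNr scaleNr scalerN opprK. Qed.

Lemma refl_self a : a != 0 -> refl a a = - a.
Proof.
rewrite -dot_eq0 /refl => a0; rewrite mulfK // scaler_nat mulr2n opprD addrA subrr.
by rewrite sub0r.
Qed.

Lemma reflK a : involutive (refl a).
Proof.
move=> x; have [->|a0] := eqVneq a 0.
  by rewrite /refl !scaler0 !subr0.
by rewrite {2}/refl reflB reflZ refl_self // scalerN opprK /refl subrK.
Qed.

Lemma refl_norm a x : dot (refl a x) (refl a x) = dot x x.
Proof. by rewrite dot_refl reflK. Qed.

Lemma refl_conj b a x : refl (refl b a) x = refl b (refl a (refl b x)).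
Proof.
by rewrite [refl a _]/refl reflB reflK reflZ /refl -/(refl b a) dot_refl refl_norm.
Qed.

End Euclid.

(** * Words in simple reflections *)

Section Chamber.
Context {R : realType} {n : nat} {Phi : {fset 'rV[R]_n}}.
Hypothesis hPhi : reduced_root_system Phi.
Variable p : 'rV[R]_n.
Hypothesis hp : forall a, a \in Phi -> dot a p != 0.
Implicit Types (x y z a b d : 'rV[R]_n) (s : seq 'rV[R]_n).

Lemma root_opp a : a \in Phi -> - a \in Phi.
Proof.
move=> aP; rewrite -(refl_self (root_neq0 hPhi aP)).
exact: (root_refl hPhi).
Qed.

Definition posroot a := (a \in Phi) && (0 < dot a p).

Lemma posrootN a : a \in Phi -> ~~ posroot a -> posroot (- a).
Proof.
move=> aP; rewrite /posroot aP root_opp //= dotNl oppr_gt0 -leNgt le_eqVlt.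
by rewrite (negPf (hp aP)).
Qed.

(** Stated as the property that the exchange argument uses, in place of
    indecomposability among the positive roots. *)
Definition simple a :=
  posroot a /\ forall b, posroot b -> b != a -> posroot (refl a b).

(** In an equality case of Cauchy-Schwarz the roots are proportional, hence
    equal because the system is reduced. *)
Lemma posroot_cs b d : posroot b -> posroot d -> d != b ->
  (dot b d) ^+ 2 < dot b b * dot d d.
Proof.
move=> /andP[bP bp] /andP[dP dp] db.
have b0 : 0 < dot b b by rewrite dot_gt0 (root_neq0 hPhi).
pose c := dot b d / dot b b.
have : 0 < dot (d - c *: b) (d - c *: b).
  rewrite dot_gt0 subr_eq0; apply/eqP => dE; move: dP; rewrite dE => dP.
  case: (root_reduced hPhi bP dP) => c1; move: dE; rewrite c1.
    by rewrite scale1r => dE; rewrite dE eqxx in db.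
  by move=> dE; move: dp; rewrite dE scaleN1r dotNl; lra.
have -> : dot (d - c *: b) (d - c *: b) = dot d d - (dot b d) ^+ 2 / dot b b.
  rewrite !(dotBl, dotBr, dotZl, dotZr) (dotC d b) /c; field.
  by rewrite gt_eqF.
by rewrite subr_gt0 ltr_pdivrMr // mulrC.
Qed.

(** Normalized, because the roots may have different lengths and the argument of
    [height_split] compares directions. *)
Definition height b := dot b p / Num.sqrt (dot b b).

(** The roots [d] and [- refl b d] have equal length and their sum is a multiple
    of [b].  As they are not parallel, the sum of their unit vectors is shorter
    than 2, and so one of them lies lower than [b]. *)
Lemma height_split b d : posroot b -> posroot d -> d != b ->
  posroot (- refl b d) ->
  exists2 c, 0 < c & c *: b = d - refl b d /\
  (height d < height b \/ height (- refl b d) < height b).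
Proof.
move=> hb hd db he.
have cs := posroot_cs hb hd db.
case/andP: (hb) (hd) (he) => bP bp /andP[dP dp] /andP[eP ep].
have b0 : 0 < dot b b by rewrite dot_gt0 (root_neq0 hPhi).
have d0 : 0 < dot d d by rewrite dot_gt0 (root_neq0 hPhi).
pose c := 2 * dot b d / dot b b.
have cE : c *: b = d - refl b d by rewrite /refl opprB addrCA subrr addr0.
have cp : c * dot b p = dot d p + dot (- refl b d) p.
  by rewrite -dotZl cE dotBl dotNl.
have c0 : 0 < c by rewrite -(pmulr_lgt0 _ bp) cp addr_gt0.
exists c => //; split=> //.
have eN : dot (- refl b d) (- refl b d) = dot d d.
  by rewrite dotNl dotNr opprK refl_norm.
rewrite /height eN.
set B := Num.sqrt (dot b b); set D := Num.sqrt (dot d d).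
have B0 : 0 < B by rewrite sqrtr_gt0.
have D0 : 0 < D by rewrite sqrtr_gt0.
have BE : B ^+ 2 = dot b b by rewrite sqr_sqrtr // ltW.
have DE : D ^+ 2 = dot d d by rewrite sqr_sqrtr // ltW.
have bd : dot b d < B * D.
  rewrite -(ltr_pXn2r (n := 2)) ?nnegrE ?mulr_ge0 // ?(ltW B0) ?(ltW D0) //.
    by rewrite exprMn BE DE.
  by move: c0; rewrite /c pmulr_lgt0 ?invr_gt0 // pmulr_rgt0 // => /ltW.
have cBD : c * B < 2 * D.
  have -> : c * B = 2 * (dot b d / B) by rewrite /c -BE; field; rewrite gt_eqF.
  by rewrite ltr_pM2l // ltr_pdivrMr // mulrC.
rewrite !ltr_pdivrMr //.
have [h1|h1] := ltP (dot d p) (dot b p / B * D); first by left.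
right; rewrite ltNge; apply/negP => h2.
have : 2 * (dot b p / B * D) <= c * dot b p by rewrite cp; lra.
rewrite leNgt => /negP; apply.
have -> : c * dot b p = c * B * (dot b p / B) by field; rewrite gt_eqF.
have -> : 2 * (dot b p / B * D) = (2 * D) * (dot b p / B) by ring.
by rewrite ltr_pM2r // divr_gt0.
Qed.

(** A segment from the chamber of [p] to [z] first leaves the chamber through a
    wall.  The root of that wall minimizes [<b, z> / <b, p>], and among the
    roots with the same ratio the proof takes one of least height. *)
Lemma simple_neg b z : posroot b -> dot b z < 0 ->
  exists2 a, simple a & dot a z < 0.
Proof.
move=> hb bz.
pose T : finType := Phi.
have bP : b \in Phi by case/andP: hb.
pose pos := [pred i : T | posroot (val i)].
pose r (i : T) := dot (val i) z / dot (val i) p.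
have hb' : pos [` bP]%fset by [].
have [i0 hi0 mini0] := arg_minP r hb'.
pose tie := [pred i : T | pos i && (r i == r i0)].
have hi0' : tie i0 by apply/andP; split.
have [i1 hi1 mini1] := arg_minP (height \o val) hi0'.
case/andP: hi1 => hi1 /eqP ri1.
set a := val i1.
have hz : dot a z < 0.
  have ap : 0 < dot a p by case/andP: hi1.
  have : r i1 <= r [` bP]%fset by rewrite ri1 mini0.
  rewrite /r /= -/a ler_pdivrMr // => h.
  apply: le_lt_trans h _; rewrite pmulr_llt0 // pmulr_llt0 // invr_gt0.
  by case/andP: hb.
exists a => //; split=> // d hd da; apply/negPn/negP => he.
have dP : d \in Phi by case/andP: hd.
have edP : refl a d \in Phi by apply: (root_refl hPhi) => //; exact: valP.
have he' : posroot (- refl a d) by apply: posrootN.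
have eP := root_opp edP.
have [c c0 [cE hh]] := height_split hi1 hd da he'.
have rd : r i0 <= r [` dP]%fset by apply: mini0.
have re : r i0 <= r [` eP]%fset by apply: mini0.
have ap : 0 < dot a p by case/andP: hi1.
have dp : 0 < dot d p by case/andP: hd.
have ep : 0 < dot (- refl a d) p by case/andP: he'.
have rd' : r i0 * dot d p <= dot d z by rewrite -ler_pdivlMr.
have re' : r i0 * dot (- refl a d) p <= dot (- refl a d) z by rewrite -ler_pdivlMr.
have sz : c * dot a z = dot d z + dot (- refl a d) z by rewrite -dotDl -cE dotZl.
have sp : c * dot a p = dot d p + dot (- refl a d) p by rewrite -dotDl -cE dotZl.
have raz : dot a z = r i0 * dot a p by rewrite -ri1 /r -/a divfK // gt_eqF.
(* [a] has minimal ratio and [c *: a] is the sum of [d] and [- refl a d], which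
   therefore have the same ratio. *)
have tot : dot d z + dot (- refl a d) z = r i0 * dot d p + r i0 * dot (- refl a d) p.
  by rewrite -sz raz mulrCA sp mulrDr.
have dE : dot d z = r i0 * dot d p by lra.
have eE : dot (- refl a d) z = r i0 * dot (- refl a d) p by lra.
case: hh => hh.
  have : height (val i1) <= height (val [` dP]%fset).
    apply: mini1; apply/andP; split; first exact: hd.
    by apply/eqP; rewrite {1}/r /= dE mulfK // gt_eqF.
  by rewrite leNgt hh.
have : height (val i1) <= height (val [` eP]%fset).
  apply: mini1; apply/andP; split; first exact: he'.
  by apply/eqP; rewrite {1}/r /= eE mulfK // gt_eqF.
by rewrite leNgt hh.
Qed.

Definition act s y := foldr (@refl R n) y s.

Definition allsimple s := forall a, a \in s -> simple a.

Lemma act_cat s1 s2 y : act (s1 ++ s2) y = act s1 (act s2 y).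
Proof. by rewrite /act foldr_cat. Qed.

(** Every reflection is a product of simple ones: conjugating by a simple root
    [a] with [<a, b> > 0] replaces the positive root [b] by one with a smaller
    product with [p]. *)
Lemma refl_word b : posroot b ->
  exists2 s, allsimple s & forall y, act s y = refl b y.
Proof.
pose below b := count (fun d => dot d p < dot b p) Phi.
move: {2}(below b).+1 (ltnSn (below b)) => m.
elim: m b => // m IH b; rewrite ltnS => bm hb.
have [bP bp] : b \in Phi /\ 0 < dot b p by apply/andP.
have b0 : 0 < dot b b by rewrite dot_gt0 (root_neq0 hPhi).
have [a sa] : exists2 a, simple a & dot a (- b) < 0.
  by apply: simple_neg hb _; rewrite dotNr oppr_lt0.
rewrite dotNr oppr_lt0 => ab.
have [->|ba] := eqVneq b a.
  by exists [:: a] => // d; rewrite inE => /eqP ->.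
have hb' : posroot (refl a b) by case: sa => _; apply.
case: (sa) => /andP[aP ap] _.
have a0 : 0 < dot a a by rewrite dot_gt0 (root_neq0 hPhi).
have lt : dot (refl a b) p < dot b p.
  rewrite /refl dotBl dotZl gtrBl mulr_gt0 // divr_gt0 // mulr_gt0 //.
have [|s hs sE] := IH (refl a b) _ hb'.
  apply: leq_trans bm; apply: (@count_lt _ _ _ _ (refl a b)) => //=.
  - by move=> d h; apply: lt_trans h lt.
  - exact: (root_refl hPhi).
  - by rewrite ltxx.
exists (a :: s ++ [:: a]).
  move=> d; rewrite inE mem_cat inE => /orP[/eqP -> //|/orP[/hs //|/eqP -> //]].
by move=> y; rewrite /= act_cat sE refl_conj !reflK.
Qed.

Lemma group_word g : refl_group Phi g ->
  exists2 s, allsimple s & forall y, act s y = g y.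
Proof.
elim=> [|a {}g aP _ [s hs sE]]; first by exists [::].
have [s' hs' sE'] : exists2 s, allsimple s & forall y, act s y = refl a y.
  have [ha|ha] := boolP (posroot a); first exact: refl_word.
  have [s' hs' sE'] := refl_word (posrootN aP ha).
  by exists s' => // y; rewrite sE' refl_opp.
exists (s' ++ s); first by move=> d; rewrite mem_cat => /orP[/hs'|/hs].
by move=> y; rewrite act_cat sE sE'.
Qed.

Definition chamber y := forall a, a \in Phi -> 0 < dot a y * dot a p.

Lemma chamber_pos y a : chamber y -> posroot a -> 0 < dot a y.
Proof. by move=> hy /andP[aP ap]; rewrite -(pmulr_lgt0 _ ap) hy. Qed.

(** The exchange property.  It is proved for an arbitrary positive root [a],
    because the induction moves [a] to [refl b a], which need not be simple. *)
Lemma exchange a s y : allsimple s -> chamber y -> posroot a ->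
  dot a (act s y) < 0 ->
  exists s', [/\ size s' < size s, allsimple s' &
                 forall x, act s x = refl a (act s' x)]%N.
Proof.
move=> + hy; elim: s a => [|b s IH] a hs ha /=.
  by move=> /(lt_trans (chamber_pos hy ha)); rewrite ltxx.
have hs' : allsimple s by move=> d ds; apply: hs; rewrite inE ds orbT.
have sb : simple b by apply: hs; rewrite inE eqxx.
have [->|ab] := eqVneq a b; first by move=> _; exists s; split.
rewrite -dot_refl => h.
have [|s' [ss hs2 E]] := IH (refl b a) hs' _ h; first by case: sb => _; apply.
exists (b :: s'); split=> //.
  by move=> d; rewrite inE => /orP[/eqP -> //|/hs2].
by move=> x; rewrite E refl_conj !reflK.
Qed.

(** If [a] is the first letter, then the rest of the word sends [y] to the
    negative side of [a], so that by [exchange] the word can be shortened. *)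
Lemma word_fix s y : allsimple s -> chamber y -> chamber (act s y) ->
  act s y = y.
Proof.
move: {2}(size s).+1 (ltnSn (size s)) => m.
elim: m s => // m IH [//|a s] sm hs hy /= hz.
have hs' : allsimple s by move=> d ds; apply: hs; rewrite inE ds orbT.
have sa : simple a by apply: hs; rewrite inE eqxx.
have ha : posroot a by case: sa.
have neg : dot a (act s y) < 0.
  have := chamber_pos hz ha; rewrite -dot_refl refl_self ?dotNl ?oppr_gt0 //.
  by apply: (root_neq0 hPhi); case/andP: ha.
have [s' [ss hs2 E]] := exchange hs' hy ha neg.
rewrite E reflK; apply: IH => //; first exact: leq_trans ss (ltnW sm).
by move: hz; rewrite E reflK.
Qed.

Lemma chamber_orbit g y : refl_group Phi g -> chamber y -> chamber (g y) ->
  g y = y.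
Proof. by move=> /group_word[s hs sE]; rewrite -!sE; apply: word_fix. Qed.

End Chamber.

(** * Orbits *)

Section Orbits.
Context {R : realType} {n : nat} {Phi : {fset 'rV[R]_n}}.
Hypothesis hPhi : reduced_root_system Phi.
Implicit Types (x y z a b : 'rV[R]_n) (g : 'rV[R]_n -> 'rV[R]_n).

Lemma group_root g a : refl_group Phi g -> a \in Phi -> g a \in Phi.
Proof. by move=> gG aP; elim: gG => //= b {}g bP _; apply: (root_refl hPhi). Qed.

Lemma groupZD g (c : R) x y : refl_group Phi g -> g (c *: x + y) = c *: g x + g y.
Proof. by elim=> //= b {}g bP _ ->; rewrite reflD reflZ. Qed.

Lemma group_norm g x : refl_group Phi g -> dot (g x) (g x) = dot x x.
Proof. by elim=> //= b {}g bP _; rewrite refl_norm. Qed.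

Lemma group_regular g y : refl_group Phi g ->
  regular_set Phi y -> regular_set Phi (g y).
Proof.
move=> gG hy; elim: gG => //= b {}g bP _ hg a aP /=.
by rewrite -dot_refl hg //; apply: (root_refl hPhi).
Qed.

Lemma group_eq g h : spanning Phi -> refl_group Phi g -> refl_group Phi h ->
  (forall a, a \in Phi -> g a = h a) -> g = h.
Proof.
move=> hspan gG hG gh; apply/funext => x.
have g0 f : refl_group Phi f -> f 0 = 0 
  by elim=> //= b {}f _ _ ->; exact: refl_fix (dot0r b).
have gsum f I (r : seq I) (c : I -> R) (F : I -> 'rV[R]_n) : refl_group Phi f ->
    f (\sum_(i <- r) c i *: F i) = \sum_(i <- r) c i *: f (F i).
  move=> fG; elim: r => [|i r IH]; first by rewrite !big_nil g0.
  by rewrite !big_cons groupZD // IH.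
have xs : x \in <<in_tuple (enum_fset Phi)>>%VS.
  by rewrite /= (_ : <<enum_fset Phi>>%VS = fullv) ?memvf.
rewrite (coord_span xs) !gsum //; apply: eq_bigr => i _.
by rewrite gh //; apply: mem_nth.
Qed.

(** The group embeds into the self-maps of the finite spanning set of roots, so
    that the sizes of all orbits have a common bound. *)
Lemma orbit_seq : spanning Phi -> exists N : nat, forall y, exists O : seq 'rV[R]_n,
  (size O <= N)%N /\
  forall z, z \in O <-> exists2 g, refl_group Phi g & z = g y.
Proof.
move=> hspan.
pose T : finType := Phi.
pose rho g := [ffun a : T => insubd a (g (val a))].
have inj : set_inj [set g | refl_group Phi g] rho.
  move=> g h /set_mem /= gG /set_mem /= hG gh; apply: (group_eq hspan) => // a aP.
  have := congr1 (fun f : {ffun T -> T} => val (f [` aP]%fset)) gh.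
  by rewrite !ffunE !insubdK //= ?group_root.
have fin : finite_set [set g | refl_group Phi g].
  by rewrite -(eq_finite_set (inj_card_eq inj)); apply: finite_finset.
have /finite_seqP[L hL] := fin.
exists (size L) => y; exists [seq g y | g : 'rV[R]_n -> 'rV[R]_n <- L].
rewrite size_map; split=> // z.
have memL g : (g \in L) <-> refl_group Phi g.
  by have := congr1 (fun A => A g) hL => /= ->.
split=> [/mapP[g gL ->]|[g /memL gL ->]]; last by apply: map_f.
by exists g => //; apply/memL.
Qed.

Lemma orbit_refl y (O : seq 'rV[R]_n) b z : b \in Phi ->
  (forall z, z \in O <-> exists2 g, refl_group Phi g & z = g y) ->
  z \in O -> refl b z \in O.
Proof.
move=> bP hO /hO[g gG ->]; apply/hO; exists (refl b \o g) => //.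
exact: refl_group_comp.
Qed.

Lemma exists_max (O : seq 'rV[R]_n) (f : 'rV[R]_n -> R) y : y \in O ->
  exists2 z, z \in O & forall z', z' \in O -> f z' <= f z.
Proof.
elim: O y => // w O IH y _; case: O IH => [_|v O /(_ v)].
  by exists w; rewrite ?inE // => z'; rewrite inE => /eqP ->.
move=> [|z zO hz]; first by rewrite inE eqxx.
have [h|/ltW h] := lerP (f w) (f z).
  exists z => [|z']; first by rewrite inE zO orbT.
  by rewrite inE => /orP[/eqP -> //|/hz].
exists w => [|z']; first by rewrite inE eqxx.
by rewrite inE => /orP[/eqP -> //|/hz h']; apply: le_trans h' h.
Qed.

(** The maximum of [<x, .>] over the orbit of [y] is attained at a point of the
    closed chamber, as reflecting in a violated root increases [<x, .>]; by
    [chamber_orbit] this point is [y]. *)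
Lemma chamber_max p x y g : spanning Phi -> regular_set Phi p ->
  chamber (Phi := Phi) p x -> chamber (Phi := Phi) p y -> refl_group Phi g ->
  dot x (g y) <= dot x y.
Proof.
move=> hspan hp hx hy gG.
have [N hN] := orbit_seq hspan; have [orb [_ hO]] := hN y.
have yO : y \in orb by apply/hO; exists id => //; apply: refl_group_id.
have [z zO hz] := exists_max (dot x) yO.
case/hO: (zO) => h hG zE.
have yreg : regular_set Phi y.
  by move=> a aP /=; apply/eqP => ay; have := hy a aP; rewrite ay mul0r ltxx.
have zc : chamber (Phi := Phi) p z.
  move=> a aP; rewrite ltNge; apply/negP => neg.
  have az : dot a z != 0 by rewrite zE; apply: (group_regular hG yreg).
  have neg' : dot a z * dot a p < 0.
    by rewrite lt_neqAle neg mulf_neq0 //; apply: hp.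
  have : dot a z * dot a x < 0.
    have := hx a aP; have ap2 : 0 < dot a p ^+ 2 by rewrite exprn_even_gt0 //; apply: hp.
    rewrite -(pmulr_rlt0 _ ap2) => ax.
    have -> : dot a p ^+ 2 * (dot a z * dot a x) =
        (dot a z * dot a p) * (dot a x * dot a p) by ring.
    by rewrite nmulr_rlt0.
  move=> zx; have := hz (refl a z) (orbit_refl aP hO zO).
  rewrite dot_reflE leNgt => /negP; apply.
  rewrite ltrDl oppr_gt0.
  have a0 : 0 < (dot a a)^-1 by rewrite invr_gt0 dot_gt0 (root_neq0 hPhi).
  have -> : 2 * dot a z / dot a a * dot a x =
      2 * (dot a a)^-1 * (dot a z * dot a x) by ring.
  by rewrite pmulr_rlt0 // mulr_gt0.
have yz : y = z by rewrite zE (chamber_orbit hPhi hp hG) // -zE.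
by rewrite {2}yz; apply: hz; apply/hO; exists g.
Qed.

(** * Sums over roots *)

Lemma sum_root_refl (V : nmodType) b (F : 'rV[R]_n -> V) : b \in Phi ->
  \sum_(a <- Phi) F (refl b a) = \sum_(a <- Phi) F a.
Proof.
move=> bP; rewrite -(big_map (refl b) xpredT F); apply: perm_big.
apply: uniq_perm; rewrite ?fset_uniq ?map_inj_uniq ?fset_uniq //.
  exact: (can_inj (reflK b)).
move=> a; apply/mapP/idP => [[c cP ->]|aP]; first exact: (root_refl hPhi).
by exists (refl b a); rewrite ?reflK //; apply: (root_refl hPhi).
Qed.

Lemma sum_root_half Phip (F : 'rV[R]_n -> R) : positive_subsystem Phi Phip ->
  (forall a, a \in Phi -> F (- a) = F a) ->
  \sum_(a <- Phip) F a = \sum_(a <- Phi) F a / 2.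
Proof.
move=> [b hb ->] hF.
have -> : \sum_(a <- [fset a in Phi | 0 < dot a b]%fset) F a
    = \sum_(a <- Phi | 0 < dot a b) F a.
  rewrite -[RHS]big_filter; apply: perm_big; apply: uniq_perm.
  - exact: fset_uniq.
  - by rewrite filter_uniq // fset_uniq.
  - by move=> a; rewrite mem_filter !inE /= andbC.
have neg : \sum_(a <- Phi | ~~ (0 < dot a b)) F a
    = \sum_(a <- Phi | 0 < dot a b) F a.
  have perm : perm_eq [seq - a | a <- Phi] Phi.
    apply: uniq_perm; first by rewrite map_inj_uniq ?fset_uniq //; apply: oppr_inj.
      exact: fset_uniq.
    move=> a; apply/mapP/idP => [[c cP ->]|aP]; first exact: root_opp.
    by exists (- a); rewrite ?opprK //; apply: root_opp.
  rewrite -(perm_big _ perm) big_map /= big_seq_cond [RHS]big_seq_cond.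
  apply: eq_big => [a|a /andP[aP _]]; last exact: hF.
  have [aP|//] := boolP (a \in Phi).
  by rewrite /= dotNl oppr_gt0 -leNgt le_eqVlt eq_sym (negPf (hb a aP)).
rewrite -mulr_suml [\sum_(a <- Phi) F a](bigID (fun a => 0 < dot a b)) /= neg.
by field.
Qed.

End Orbits.

(** * Analytic functions have directional derivatives *)

Section Analytic.
Context {R : realType} {n : nat}.
Let mi := {ffun 'I_n -> nat}.
Let deg (m : mi) : nat := (\sum_(i < n) m i)%N.
Implicit Types (u : mi -> R) (s : R) (D : set mi).
Implicit Types (f : 'rV[R]_n -> R) (x xi eta : 'rV[R]_n).

Lemma esumZ_le (T : choiceType) (D : set T) (u : T -> \bar R) s : 0 <= s ->
  (forall m, 0 <= u m)%E ->
  (\esum_(m in D) (s%:E * u m) <= s%:E * \esum_(m in D) u m)%E.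
Proof.
move=> s0 u0; apply: ge_ereal_sup => _ [A [fA AD] <-].
rewrite -ge0_mule_fsumr //; apply: lee_wpmul2l; first by rewrite lee_fin.
by apply: esum_ge; exists A.
Qed.

Lemma esumZ (T : choiceType) (D : set T) (u : T -> \bar R) s : 0 <= s ->
  (forall m, 0 <= u m)%E ->
  (\esum_(m in D) (s%:E * u m) = s%:E * \esum_(m in D) u m)%E.
Proof.
rewrite le_eqVlt => /predU1P[<-|s0] u0.
  by rewrite mul0e esum1 // => m _; rewrite mul0e.
apply/eqP; rewrite eq_le esumZ_le ?(ltW s0) //= muleC -lee_pdivlMr // muleC.
rewrite -[leLHS](_ : (\esum_(m in D) ((s^-1)%:E * (s%:E * u m)))%E = _); last first.
  apply: eq_esum => m _; rewrite muleA -EFinM mulVf ?mul1e //.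
  by rewrite gt_eqF.
apply: esumZ_le; first by rewrite invr_ge0 ltW.
by move=> m; rewrite mule_ge0 // lee_fin ltW.
Qed.

(** The terms of degree at least 2 sum to at most [s ^+ 2] times the whole sum
    at [s = 1]; this is all that the derivative at 0 needs. *)
Lemma esum_expand u : (forall m, 0 <= u m) ->
  (\esum_(m in [set: mi]) (u m)%:E < +oo)%E ->
  exists A, exists2 C, 0 <= C &
  forall s, 0 <= s <= 1 -> exists2 rho, 0 <= rho <= C &
  (\esum_(m in [set: mi]) (u m * s ^+ deg m)%:E)%E =
    (A + s * fine (\esum_(m in [set m | deg m = 1%N]) (u m)%:E)%E + s ^+ 2 * rho)%:E.
Proof.
move=> u0 ufin.
have u0' m : (0 <= (u m)%:E)%E by rewrite lee_fin.
have sub D : (\esum_(m in D) (u m)%:E <= \esum_(m in [set: mi]) (u m)%:E)%E.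
  by rewrite [leRHS](esumID D) // setTI leeDl // esum_ge0.
have fin D : (\esum_(m in D) (u m)%:E)%E \is a fin_num.
  rewrite ge0_fin_numE; first exact: le_lt_trans (sub D) ufin.
  exact: esum_ge0.
exists (fine (\esum_(m in [set m | deg m = 0%N]) (u m)%:E)%E).
exists (fine (\esum_(m in [set: mi]) (u m)%:E)%E); first by rewrite fine_ge0 // esum_ge0.
move=> s /andP[s0 s1].
have us0 m : (0 <= (u m * s ^+ deg m)%:E)%E by rewrite lee_fin mulr_ge0 // exprn_ge0.
pose hi := ~` [set m | deg m = 0%N] `&` ~` [set m | deg m = 1%N].
have hile : (\esum_(m in hi) (u m * s ^+ deg m)%:E <=
    (s ^+ 2)%:E * \esum_(m in [set: mi]) (u m)%:E)%E.
  apply: (@le_trans _ _ (\esum_(m in hi) ((s ^+ 2)%:E * (u m)%:E))%E).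
    apply: le_esum => m [/eqP m0 /eqP m1]; rewrite -EFinM lee_fin mulrC.
    apply: ler_wpM2r => //; apply: ler_wiXn2l => //.
    by case: (deg m) m0 m1 => [//|[//|]].
  rewrite esumZ ?exprn_ge0 //; apply: lee_wpmul2l; rewrite ?lee_fin ?exprn_ge0 //.
have hifin : (\esum_(m in hi) (u m * s ^+ deg m)%:E)%E \is a fin_num.
  rewrite ge0_fin_numE; last exact: esum_ge0.
  apply: le_lt_trans hile _; rewrite -(fineK (fin setT)) -EFinM ltry //.
have [rho [rho0 rhoE]] : exists rho, 0 <= rho <= fine (\esum_(m in [set: mi]) (u m)%:E)%E
    /\ (\esum_(m in hi) (u m * s ^+ deg m)%:E)%E = (s ^+ 2 * rho)%:E.
  move: s0; rewrite le_eqVlt => /predU1P[s0|s0].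
    exists 0; rewrite lexx fine_ge0 ?esum_ge0 //; split=> //.
    rewrite mulr0; apply/eqP; rewrite eq_le esum_ge0 // andbT.
    by move: hile; rewrite -s0 expr0n mul0e.
  have s20 : 0 < s ^+ 2 by rewrite exprn_gt0.
  exists (fine (\esum_(m in hi) (u m * s ^+ deg m)%:E)%E / s ^+ 2); split.
    rewrite divr_ge0 ?(ltW s20) ?fine_ge0 ?esum_ge0 //= ler_pdivrMr // mulrC.
    by rewrite -lee_fin fineK // EFinM fineK.
  by rewrite mulrC divfK ?gt_eqF // fineK.
exists rho => //.
rewrite (esumID [set m | deg m = 0%N]) // setTI.
rewrite [X in (_ + X)%E](esumID [set m | deg m = 1%N]) // setTI.
have -> : ~` [set m | deg m = 0%N] `&` [set m | deg m = 1%N] = [set m | deg m = 1%N].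
  by apply/seteqP; split=> m /= => [[]//|e]; split=> //; rewrite e.
rewrite -/hi rhoE !EFinD addeA; congr (_ + _ + _)%E.
- by rewrite fineK //; apply: eq_esum => m /= ->; rewrite expr0 mulr1.
- rewrite EFinM fineK // -esumZ //; apply: eq_esum => m /= ->.
  by rewrite expr1 -EFinM mulrC.
Qed.

Lemma monomialZ (s : R) (m : mi) eta :
  monomial m (s *: eta) = s ^+ deg m * monomial m eta.
Proof.
rewrite /monomial /deg expr_sum -big_split /=; apply: eq_bigr => i _.
by rewrite mxE exprMn.
Qed.

Let plus (a : mi -> R) m := Num.max (a m) 0.
Let lin (a : mi -> R) :=
  fine (\esum_(m in [set m | deg m = 1%N]) (plus a m)%:E)%E -
  fine (\esum_(m in [set m | deg m = 1%N]) (plus (fun m => - a m) m)%:E)%E.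

Lemma ray_expansion (g : R -> R) (a : mi -> R) :
  summable [set: mi] (fun m => (a m)%:E) ->
  (forall s : R, 0 <= s <= 1 ->
    let term := fun m : mi => (a m * s ^+ deg m)%:E in
    ((g s)%:E = \esum_(m in [set: mi]) (term^\+ m)%E
              - \esum_(m in [set: mi]) (term^\- m)%E)%E) ->
  exists2 C, 0 <= C &
    forall s, 0 <= s <= 1 -> `|g s - g 0 - s * lin a| <= C * s ^+ 2.
Proof.
move=> sa hg.
have plus_ge0 b m : 0 <= plus b m by rewrite /plus le_max lexx orbT.
have plus_le b m : plus b m <= `|b m|.
  by rewrite /plus ge_max ler_norm normr_ge0.
have fin b : (forall m, `|b m| = `|a m|) ->
    (\esum_(m in [set: mi]) (plus b m)%:E < +oo)%E.
  move=> ba; apply: le_lt_trans sa; apply: le_esum => m _.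
  by rewrite abse_EFin lee_fin -ba.
have fin1 := fin a (fun=> erefl).
have fin2 := fin (fun m => - a m) (fun m => normrN (a m)).
have [A1 [C1 C10 h1]] := esum_expand (plus_ge0 a) fin1.
have [A2 [C2 C20 h2]] := esum_expand (plus_ge0 (fun m => - a m)) fin2.
have key s : 0 <= s <= 1 -> exists2 rho, `|rho| <= C1 + C2 &
    g s = A1 - A2 + s * lin a + s ^+ 2 * rho.
  move=> s01; have [r1 /andP[r10 r1C] e1] := h1 s s01.
  have [r2 /andP[r20 r2C] e2] := h2 s s01.
  exists (r1 - r2).
    by rewrite ler_norml; apply/andP; split; lra.
  have s0 m : 0 <= s ^+ deg m by rewrite exprn_ge0 //; case/andP: s01.
  have s1 m : s ^+ deg m <= 1 by case/andP: s01 => ? ?; rewrite exprn_ile1.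
  have summ b : (\esum_(m in [set: mi]) (plus b m)%:E < +oo)%E ->
      summable [set: mi] (fun m => (plus b m * s ^+ deg m)%:E).
    apply: le_lt_trans; apply: le_esum => m _.
    rewrite abse_EFin lee_fin ger0_norm ?mulr_ge0 //.
    by rewrite ler_piMr.
  have nn b m : [set: mi] m -> (0 <= (plus b m * s ^+ deg m)%:E)%E.
    by move=> _; rewrite lee_fin mulr_ge0.
  have := esumB (summ _ fin1) (summ _ fin2) (nn a) (nn _).
  have -> : (fun m : mi => ((plus a m * s ^+ deg m)%:E - (plus (fun m => - a m) m * s ^+ deg m)%:E)%E)
      = (fun m => (a m * s ^+ deg m)%:E).
    apply/funext => m; rewrite -EFinB -mulrBl; congr (_ * _)%:E.
    by rewrite /plus; case: lerP => ?; case: lerP => ?; lra.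
  move=> E; have := hg s s01; rewrite /= E.
  rewrite e1 e2 -EFinB => -[->]; rewrite /lin; ring.
have [|r0 _ g0] := key 0; first by rewrite lexx ler01.
exists (C1 + C2); first exact: addr_ge0.
move=> s s01; have [r rC ->] := key s s01; rewrite g0.
have -> : A1 - A2 + s * lin a + s ^+ 2 * r - (A1 - A2 + 0 * lin a + 0 ^+ 2 * r0) - s * lin a
    = r * s ^+ 2 by ring.
by rewrite normrM (ger0_norm (sqr_ge0 s)) ler_wpM2r ?sqr_ge0.
Qed.

(** The definition of analyticity expresses a sum as a difference of two
    nonnegative sums, so the expansion is first proved along a ray; the two
    rays of a line have opposite linear terms. *)
Lemma analytic_derivable f x xi : real_analytic f -> derivable f x xi.
Proof.
move=> /(_ x)[r [c [r0 hr]]].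
pose t0 := r / 2 / (1 + \sum_(i < n) `|xi 0 i|).
have S0 : 0 < 1 + \sum_(i < n) `|xi 0 i|.
  by rewrite ltr_wpDr // sumr_ge0.
have t00 : 0 < t0 by rewrite !divr_gt0.
pose eta := t0 *: xi.
have small (s : R) i : `|s| <= 1 -> `|(s *: eta) 0 i| < r.
  move=> s1; rewrite !mxE normrM.
  apply: (@le_lt_trans _ _ (r / 2)); last by lra.
  apply: (@le_trans _ _ `|t0 * xi 0 i|).
    by rewrite ler_piMl.
  have rn : `|xi 0 i| <= 1 + \sum_(i < n) `|xi 0 i|.
    by rewrite (bigD1 i) //= addrCA lerDl addr_ge0 // sumr_ge0.
  rewrite normrM (gtr0_norm t00) /t0 mulrAC ler_pdivrMr // ler_wpM2l //.
  by rewrite divr_ge0 // ltW.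
pose a sg m := c m * monomial m (sg *: eta).
have exp sg : `|sg| = 1 -> exists2 C, 0 <= C & forall s, 0 <= s <= 1 ->
    `|f (x + (s * sg) *: eta) - f x - s * lin (a sg)| <= C * s ^+ 2.
  move=> sg1.
  have [|s s01|C C0 hC] := @ray_expansion (fun s => f (x + (s * sg) *: eta)) (a sg).
  - by have [|] := hr (sg *: eta) => // i; apply: small; rewrite sg1.
  - have [|_ /=] := hr ((s * sg) *: eta).
      move=> i; apply: small; rewrite normrM sg1 mulr1.
      by case/andP: s01 => ? ?; rewrite ger0_norm.
    have -> : (fun m : mi => (c m * monomial m ((s * sg) *: eta))%:E)
        = (fun m : mi => (a sg m * s ^+ deg m)%:E).
      by apply/funext => m; rewrite -scalerA monomialZ /a; congr (_%:E); ring.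
    by [].
  exists C => // s s01; have := hC s s01.
  by rewrite mul0r scale0r addr0.
have [C1 C10 h1] := exp 1 (normr1 _).
have [C2 C20 h2] := exp (-1) (normrN1 _).
have linN : lin (a (-1)) = - lin (a 1).
  have odd m : deg m = 1%N -> a (-1) m = - a 1 m.
    by rewrite /a !monomialZ => ->; ring.
  rewrite /lin opprB; congr (fine _ - fine _); apply: eq_esum => m /= /odd e.
    by rewrite /plus /= e.
  by rewrite /plus /= e opprK.
rewrite linN in h2; set L := lin (a 1) in h1 h2.
pose C := C1 + C2.
have bound h : `|h| <= t0 -> `|f (h *: xi + x) - f x - h / t0 * L| <= C * (h / t0) ^+ 2.
  move=> ht.
  have e : h *: xi = (h / t0) *: eta by rewrite scalerA divfK ?gt_eqF.
  have [h0|h0] := lerP 0 h.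
    have s01 : 0 <= h / t0 <= 1.
      by rewrite divr_ge0 ?(ltW t00) //= ler_pdivrMr // mul1r -(ger0_norm h0).
    have := h1 _ s01; rewrite mulr1 -e (addrC x) => H; apply: le_trans H _.
    by rewrite ler_wpM2r ?sqr_ge0 // lerDl.
  have s01 : 0 <= - h / t0 <= 1.
    rewrite divr_ge0 ?(ltW t00) ?oppr_ge0 ?(ltW h0) //= ler_pdivrMr // mul1r.
    by rewrite -(ltr0_norm h0).
  have := h2 _ s01; rewrite mulrN1 mulNr opprK -e (addrC x) => H.
  rewrite -[X in X * L]opprK mulNr -mulrN; apply: le_trans H _.
  by rewrite sqrrN ler_wpM2r ?sqr_ge0 // lerDr.
suff H : h^-1 *: (f (h *: xi + x) - f x) @[h --> 0^'] --> L / t0.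
  by apply/cvg_ex; exists (L / t0).
apply/cvgrPdist_le => e e0.
have C0 : 0 <= C by apply: addr_ge0.
have C1p : 0 < C + 1 by lra.
near=> h.
have hn0 : h != 0 by near: h; exact: nbhs_dnbhs_neq.
have ht : `|h| <= t0.
  near: h; apply: dnbhs0_le; exact: t00.
have he : `|h| <= e * t0 ^+ 2 / (C + 1).
  near: h; apply: dnbhs0_le; apply: divr_gt0 => //.
  by apply: mulr_gt0 => //; apply: exprn_gt0.
have -> : L / t0 - h^-1 *: (f (h *: xi + x) - f x) =
    - h^-1 * (f (h *: xi + x) - f x - h / t0 * L).
  by rewrite /GRing.scale /=; field; rewrite hn0 gt_eqF.
rewrite normrM normrN normfV ler_pdivrMl ?normr_gt0 //.
apply: le_trans (bound h ht) _.
rewrite ler_pdivlMr // in he.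
have -> : C * (h / t0) ^+ 2 = `|h| * (C * `|h| / t0 ^+ 2).
  by rewrite expr_div_n -(real_normK (num_real h)); field; rewrite gt_eqF.
rewrite ler_wpM2l // ler_pdivrMr ?exprn_gt0 //.
by apply: le_trans he; rewrite mulrC ler_wpM2l // lerDl.
Unshelve. all: by end_near. Qed.

End Analytic.

(** * Functions of one variable *)

Section Calculus.
Context {R : realType}.
Implicit Types (f g : R -> R) (s t d : R).

Lemma is_derive_left_min g d t0 t : is_derive t 1 g d -> t0 < t ->
  (forall s, t0 <= s <= t -> g t <= g s) -> d <= 0.
Proof.
move=> [dg ddg] t0t gmin; rewrite leNgt; apply/negP => d0.
have : h^-1 *: (g (h *: 1 + t) - g t) @[h --> 0^'] --> d.
  by rewrite -ddg; exact: dg.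
move=> /cvgr_gt /(_ _ d0); rewrite near_withinE => /nbhs_ballP[e /= e0 he].
pose h := - Num.min (e / 2) (t - t0).
have hlt : h < 0 by rewrite /h oppr_lt0 lt_min divr_gt0 //= subr_gt0.
have : 0 < h^-1 *: (g (h *: 1 + t) - g t).
  apply: he; last by rewrite lt_eqF.
  rewrite /ball /= sub0r normrN ltr0_norm // /h opprK gt_min; apply/orP; left; lra.
rewrite /GRing.scale /= mulr1 nmulr_rgt0 ?invr_lt0 // subr_lt0 ltNge => /negP; apply.
have hm : Num.min (e / 2) (t - t0) <= t - t0 by rewrite ge_min lexx orbT.
apply: gmin; rewrite gerDr (ltW hlt) andbT /h; lra.
Qed.

Lemma is_derive_within (g g' : R -> R) t0 t1 :
  (forall t, t0 <= t <= t1 -> is_derive t 1 g (g' t)) ->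
  {within `[t0, t1], continuous g}.
Proof.
move=> dg; apply: derivable_within_continuous => t; rewrite in_itv /= => ht.
by case: (dg t ht).
Qed.

Lemma is_derive_nondecr (g g' : R -> R) t0 t1 : t0 <= t1 ->
  (forall t, t0 <= t <= t1 -> is_derive t 1 g (g' t)) ->
  (forall t, t0 <= t <= t1 -> 0 <= g' t) -> g t0 <= g t1.
Proof.
move=> t01 dg g0.
have inc t : t \in `]t0, t1[ -> t0 <= t <= t1.
  by rewrite in_itv /= => /andP[/ltW -> /ltW ->].
apply: (@ger0_derive1_ndecr _ g t0 t1) => //.
- by move=> t /inc ht; case: (dg t ht).
- by move=> t /inc ht; rewrite derive1E; case: (dg t ht) => _ ->; apply: g0.
- exact: is_derive_within dg.
Qed.

Lemma is_derive_prod f g df dg t : is_derive t 1 f df -> is_derive t 1 g dg ->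
  is_derive t 1 (fun s => f s * g s) (df * g t + f t * dg).
Proof.
move=> hf hg; have := is_deriveM hf hg.
by rewrite /GRing.scale /= => h; apply: is_derive_eq h _; ring.
Qed.

Lemma is_derive_exp f df t : is_derive t 1 f df ->
  is_derive t 1 (fun s => expR (f s)) (expR (f t) * df).
Proof. by move=> hf; apply: (is_derive1_comp (is_derive_expR (f t)) hf). Qed.

End Calculus.

(** * The maximum principle *)

Section MaxPrinciple.
Context {R : realType} {n : nat} {Phi : {fset 'rV[R]_n}}.
Variable kap : 'rV[R]_n -> R.
Hypothesis kap_ge0 : forall a, a \in Phi -> 0 <= kap a.
Let gam := \sum_(a <- Phi) kap a.

(** A negative minimum over time and orbit of [exp (- (K + 1) t) F] is excluded:
    there the time derivative is at most 0, while the coupling terms are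
    minimal at the point itself, so that the differential inequality makes it
    positive.  The inequality is thus needed only where [F] is negative, and
    only for positive times, where the system is not singular. *)
Lemma max_principle (orb : seq 'rV[R]_n) (t0 T K : R) (F F' b : R -> 'rV[R]_n -> R) :
  (forall a z, a \in Phi -> z \in orb -> refl a z \in orb) -> 0 <= t0 ->
  (forall z t, z \in orb -> t0 <= t <= T -> is_derive t 1 (F ^~ z) (F' t z)) ->
  (forall z t, z \in orb -> t0 < t <= T -> F t z < 0 ->
     b t z * F t z + \sum_(a <- Phi) kap a * F t (refl a z) <= t * F' t z) ->
  (forall z t, z \in orb -> t0 < t <= T -> b t z + gam <= K * t) ->
  (forall z, z \in orb -> 0 <= F t0 z) ->
  forall z t, z \in orb -> t0 <= t <= T -> 0 <= F t z.
Proof.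
move=> orbP t00 dF ode bK F0 z t zO tT; rewrite leNgt; apply/negP => Fneg.
have t0T : t0 <= T by case/andP: tT; apply: le_trans.
pose G s w := expR (- (K + 1) * s) * F s w.
have dG s w : w \in orb -> t0 <= s <= T -> is_derive s 1 (G ^~ w)
    (expR (- (K + 1) * s) * (F' s w - (K + 1) * F s w)).
  move=> wO sT.
  have d1 : is_derive s 1 (fun s => - (K + 1) * s) (- (K + 1)).
    by apply: is_derive_eq (is_deriveZ _ (is_derive_id s 1)) _; rewrite /GRing.scale /= mulr1.
  by apply: is_derive_eq (is_derive_prod (is_derive_exp d1) (dF w s wO sT)) _; ring.
have /choice[c hc] w : exists c, w \in orb -> t0 <= c <= T /\
    forall s, t0 <= s <= T -> G c w <= G s w.
  have [wO|wO] := boolP (w \in orb); last by exists 0.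
  have [c cT hc] := EVT_min t0T (is_derive_within (fun s sT => dG s w wO sT)).
  exists c => _; split; first by move: cT; rewrite in_itv.
  by move=> s sT; apply: hc; rewrite in_itv.
have [w wO hw] := exists_max (fun w => - G (c w) w) zO.
have [cT cmin] := hc w wO.
have gmin s v : v \in orb -> t0 <= s <= T -> G (c w) w <= G s v.
  move=> vO sT; apply: le_trans (_ : G (c v) v <= _); first by rewrite -lerN2 hw.
  by have [_] := hc v vO; apply.
set s := c w in cT gmin.
have eK x : 0 < expR (- (K + 1) * x) by exact: expR_gt0.
have Fs : F s w < 0.
  rewrite -(pmulr_rlt0 _ (eK s)); apply: le_lt_trans (gmin t z zO tT) _.
  by rewrite /G pmulr_rlt0.
have st0 : t0 < s.
  rewrite lt_neqAle; case/andP: (cT) => -> _; rewrite andbT; apply/eqP => e.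
  by have := F0 w wO; rewrite e leNgt Fs.
have sT : t0 < s <= T by rewrite st0; case/andP: cT.
have s0 : 0 < s by apply: le_lt_trans t00 st0.
have dle0 : expR (- (K + 1) * s) * (F' s w - (K + 1) * F s w) <= 0.
  apply: is_derive_left_min (dG s w wO cT) st0 _ => r /andP[r0 rs].
  by apply: gmin => //; rewrite r0 (le_trans rs) //; case/andP: cT.
have : s * (F' s w - (K + 1) * F s w) <= 0.
  by rewrite pmulr_rle0 // -(pmulr_rle0 _ (eK s)).
rewrite leNgt => /negP; apply; rewrite mulrBr subr_gt0.
apply: lt_le_trans (ode w s wO sT Fs).
have Fmin v : v \in orb -> F s w <= F s v.
  by move=> vO; rewrite -(ler_pM2l (eK s)); apply: gmin.
have sumle : gam * F s w <= \sum_(a <- Phi) kap a * F s (refl a w).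
  rewrite /gam mulr_suml big_seq [leRHS]big_seq; apply: ler_sum => a aP.
  by rewrite ler_wpM2l ?kap_ge0 ?Fmin ?orbP.
apply: lt_le_trans (_ : (b s w + gam) * F s w <= _); last by rewrite mulrDl lerD2l.
rewrite mulrA ltr_nM2r //; apply: le_lt_trans (bK w s wO sT) _.
by rewrite mulrDr mulr1 mulrC ltrDl.
Qed.

End MaxPrinciple.

(** * Joint eigenfunctions of the Dunkl operators *)

Section Eigen.
Context {R : realType} {n : nat} {Phi : {fset 'rV[R]_n}}.
Variable kap : 'rV[R]_n -> R.
Hypotheses (hPhi : reduced_root_system Phi) (hspan : spanning Phi).
Hypothesis kap_ge0 : forall a, a \in Phi -> 0 <= kap a.
Hypothesis kap_refl : forall a b, a \in Phi -> b \in Phi -> kap (refl b a) = kap a.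
Implicit Types (x y z xi a b : 'rV[R]_n) (t s : R) (orb : seq 'rV[R]_n).

Definition gam := \sum_(a <- Phi) kap a.

(** In the application [kap] is half the multiplicity, as the sums run over all
    roots.  On a ray the factor [t] cancels the singularity of the reflection terms, so that
    [eigen_rad] holds also on the reflecting hyperplanes. *)
Record eigenfun y (u : 'rV[R]_n -> R) : Prop := {
  eigen_line : forall x xi t,
    is_derive t 1 (fun s => u (x + s *: xi)) ('D_xi u (x + t *: xi));
  eigen_rad : forall x t, t * 'D_x u (t *: x) =
    (t * dot y x - gam) * u (t *: x) + \sum_(a <- Phi) kap a * u (t *: refl a x);
  eigen_dir : forall x xi, (forall a, a \in Phi -> kap a != 0 -> dot a x != 0) ->
    'D_xi u x = dot y xi * u x
      - \sum_(a <- Phi) kap a * (dot a xi / dot a x) * (u x - u (refl a x))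
}.

Lemma gam_ge0 : 0 <= gam.
Proof. by rewrite /gam big_seq; apply: sumr_ge0. Qed.

Lemma eigen_ray y u z t : eigenfun y u ->
  is_derive t 1 (fun s => u (s *: z)) ('D_z u (t *: z)).
Proof.
move=> hu; have := eigen_line hu 0 z t; rewrite add0r.
by under eq_fun do rewrite add0r.
Qed.

Definition closed_orb orb := forall a z, a \in Phi -> z \in orb -> refl a z \in orb.

Definition radial_system orb y (F F' : R -> 'rV[R]_n -> R) :=
  (forall z t, z \in orb -> 0 <= t -> is_derive t 1 (F ^~ z) (F' t z)) /\
  (forall z t, z \in orb -> 0 <= t -> t * F' t z =
     (t * dot y z - gam) * F t z + \sum_(a <- Phi) kap a * F t (refl a z)).

Lemma radial_ge0 orb y F F' : closed_orb orb ->
  (forall z t, z \in orb -> 0 <= t -> is_derive t 1 (F ^~ z) (F' t z)) ->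
  (forall z t, z \in orb -> 0 <= t ->
     (t * dot y z - gam) * F t z + \sum_(a <- Phi) kap a * F t (refl a z)
     <= t * F' t z) ->
  (forall z, z \in orb -> 0 <= F 0 z) ->
  forall z t, z \in orb -> 0 <= t -> 0 <= F t z.
Proof.
move=> orbP dF ode F0 z t zO t0.
have [v vO hv] := exists_max (dot y) zO.
apply: (max_principle kap_ge0 (orb := orb) (t0 := 0) (T := t) (K := dot y v)
  (b := fun t z => t * dot y z - gam) (F' := F')) => //.
- by move=> w s wO /andP[s0 _]; exact: dF.
- by move=> w s wO /andP[/ltW s0 _] _; apply: ode.
- move=> w s wO /andP[s0 _]; rewrite subrK mulrC ler_wpM2r ?hv //.
  exact: ltW.
- by rewrite t0 lexx.
Qed.

Lemma radial_unique orb y F F' G G' : closed_orb orb ->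
  radial_system orb y F F' -> radial_system orb y G G' ->
  (forall z, z \in orb -> F 0 z = G 0 z) ->
  forall z t, z \in orb -> 0 <= t -> F t z = G t z.
Proof.
move=> orbP [dF oF] [dG oG] FG z t zO t0.
have main F1 F1' F2 F2' : radial_system orb y F1 F1' -> radial_system orb y F2 F2' ->
    (forall z, z \in orb -> F1 0 z = F2 0 z) -> F1 t z <= F2 t z.
  move=> [d1 o1] [d2 o2] e; rewrite -subr_ge0.
  apply: (radial_ge0 (y := y) (F := fun s w => F2 s w - F1 s w)
    (F' := fun s w => F2' s w - F1' s w) orbP) => //.
  - move=> w s wO s0; exact: is_deriveB (d2 w s wO s0) (d1 w s wO s0).
  - move=> w s wO s0; rewrite [leRHS]mulrBr o1 // o2 //.
    under eq_bigr do rewrite mulrBr; rewrite sumrB; lra.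
  - by move=> w wO; rewrite e // subrr.
by apply/eqP; rewrite eq_le !(main F F' G G', main G G' F F') // => w /FG.
Qed.

Lemma eigen_system orb y u : eigenfun y u ->
  radial_system orb y (fun t z => u (t *: z)) (fun t z => 'D_z u (t *: z)).
Proof.
by move=> hu; split=> z t _ _; [apply: eigen_ray hu|apply: (eigen_rad hu)].
Qed.

Lemma orbit_exists z : exists orb, [/\ closed_orb orb, z \in orb &
  forall w, w \in orb <-> exists2 g, refl_group Phi g & w = g z].
Proof.
have [N hN] := orbit_seq hPhi hspan; have [orb [_ hO]] := hN z.
exists orb; split=> //; first by move=> a w aP; apply: (orbit_refl aP hO).
by apply/hO; exists id => //; apply: refl_group_id.
Qed.

Lemma eigen0 y u : eigenfun y u -> u 0 = 0 -> u =1 (fun=> 0).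
Proof.
move=> hu u0 z; have [orb [orbP zO _]] := orbit_exists z.
have zs : radial_system orb y (fun _ _ => 0) (fun _ _ => 0).
  split=> w s _ _; first exact: is_derive_cst.
  by rewrite !mulr0 big1 ?addr0 // => a _; rewrite mulr0.
have := radial_unique orbP (eigen_system orb hu) zs _ zO ler01.
by rewrite scale1r; apply => w _; rewrite scale0r.
Qed.

Variable e : 'rV[R]_n -> 'rV[R]_n -> R.
Hypothesis he : forall y, eigenfun y (e ^~ y).
Hypothesis e0 : forall y, e 0 y = 1.

Lemma kernel_ge0 x y : 0 <= e x y.
Proof.
have [orb [orbP xO _]] := orbit_exists x.
have [d o] := eigen_system orb (he y).
have := radial_ge0 orbP d _ _ xO ler01; rewrite scale1r; apply.
  by move=> z t zO t0; rewrite o.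
by move=> z _; rewrite scale0r e0.
Qed.

Lemma kernel_le_exp orb x y m t : closed_orb orb -> x \in orb -> 0 <= t ->
  (forall z, z \in orb -> dot y z <= m) -> e (t *: x) y <= expR (t * m).
Proof.
move=> orbP xO t0 hm; have [d o] := eigen_system orb (he y).
rewrite -subr_ge0.
apply: (radial_ge0 (y := y) (F := fun t z => expR (t * m) - e (t *: z) y)
  (F' := fun t z => expR (t * m) * m - 'D_z (e ^~ y) (t *: z)) orbP) => //.
- move=> z s zO s0; apply: is_deriveB (d z s zO s0).
  apply: is_derive_exp.
  by apply: is_derive_eq (is_deriveM (is_derive_id s 1) (is_derive_cst m s 1)) _;
     rewrite /GRing.scale /= mulr0 add0r mulr1.
- move=> z s zO s0; rewrite [leRHS]mulrBr o //.
  under eq_bigr do rewrite mulrBr; rewrite sumrB -mulr_suml -/gam.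
  have : s * dot y z * expR (s * m) <= s * m * expR (s * m).
    by rewrite ler_pM2r ?expR_gt0 // ler_wpM2l // hm.
  lra.
- by move=> z _; rewrite mul0r expR0 scale0r e0 subrr.
Qed.

Lemma kernel_refl b z y : b \in Phi -> e (refl b z) (refl b y) = e z y.
Proof.
move=> bP; have [orb [orbP zO _]] := orbit_exists z.
have [d1 o1] := eigen_system orb (he y).
suff sys : radial_system orb y (fun t z => e (t *: refl b z) (refl b y))
    (fun t z => 'D_(refl b z) (e ^~ (refl b y)) (t *: refl b z)).
  have := radial_unique orbP sys (eigen_system orb (he y)) _ zO ler01.
  by rewrite !scale1r; apply => w _; rewrite !scale0r !e0.
split=> w t wO t0; first apply: eigen_ray (he _).
rewrite (eigen_rad (he (refl b y))) dot_refl reflK; congr (_ + _).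
rewrite -(sum_root_refl hPhi _ bP) big_seq [RHS]big_seq; apply: eq_bigr => a aP.
by rewrite kap_refl // refl_conj reflK.
Qed.

(** Both sides solve the radial system over the orbit of [z]: the reflections act
    on [t *: y] on the right-hand side, and by [kernel_refl] they can be moved
    to [z]. *)
Lemma kernel_scale_sym z y t : 0 <= t -> e (t *: z) y = e (t *: y) z.
Proof.
move=> t0; have [orb [orbP zO _]] := orbit_exists z.
suff sys : radial_system orb y (fun t z => e (t *: y) z)
    (fun t z => 'D_y (e ^~ z) (t *: y)).
  apply: (radial_unique orbP (eigen_system orb (he y)) sys _ zO t0).
  by move=> w _; rewrite !scale0r !e0.
split=> w s wO s0; first apply: eigen_ray (he _).
rewrite (eigen_rad (he w)) dotC; congr (_ + _).
rewrite big_seq [RHS]big_seq; apply: eq_bigr => a aP.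
by rewrite -reflZ -[e (s *: y) _](kernel_refl _ _ aP) reflK.
Qed.

Lemma kernel_sym x y : e x y = e y x.
Proof. by have := kernel_scale_sym x y ler01; rewrite !scale1r. Qed.

Lemma kernel_scale x y t : 0 <= t -> e (t *: x) y = e x (t *: y).
Proof. by move=> t0; rewrite kernel_scale_sym // kernel_sym. Qed.

End Eigen.

(** * The bounds *)

Section Bound.
Context {R : realType} {n : nat} {Phi : {fset 'rV[R]_n}}.
Variable kap : 'rV[R]_n -> R.
Hypotheses (hPhi : reduced_root_system Phi) (hspan : spanning Phi).
Hypothesis kap_ge0 : forall a, a \in Phi -> 0 <= kap a.
Hypothesis kap_refl : forall a b, a \in Phi -> b \in Phi -> kap (refl b a) = kap a.
Variable e : 'rV[R]_n -> 'rV[R]_n -> R.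
Hypothesis he : forall y, eigenfun (Phi := Phi) kap y (e ^~ y).
Hypothesis e0 : forall y, e 0 y = 1.
Variable p : 'rV[R]_n.
Hypothesis hp : regular_set Phi p.
Implicit Types (x y z xi a b : 'rV[R]_n) (t s m w K : R) (orb : seq 'rV[R]_n).

Let g0 := gam (Phi := Phi) kap.
Let g0_ge0 : 0 <= g0. Proof. exact: gam_ge0. Qed.
Let e_ge0 : forall x y, 0 <= e x y. Proof. exact: (kernel_ge0 hPhi hspan kap_ge0 he). Qed.

(** The logarithm of the square root of the weight; the squares keep it
    differentiable without a choice of signs. *)
Definition logw x := \sum_(a <- Phi) kap a / 2 * ln (dot a x ^+ 2).

(** The chamber of [p] for the roots of positive multiplicity only, which may be
    larger than the chamber of [p]. *)
Definition wall_pos x :=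
  forall a, a \in Phi -> kap a != 0 -> 0 < dot a x * dot a p.

Definition nkernel x y := expR (logw x + logw y - dot x y) * e x y.

Lemma logw_refl b x : b \in Phi -> logw (refl b x) = logw x.
Proof.
move=> bP; rewrite /logw -[LHS](sum_root_refl hPhi _ bP) big_seq [RHS]big_seq.
by apply: eq_bigr => a aP; rewrite kap_refl // dot_refl reflK.
Qed.

Lemma logw_group g x : refl_group Phi g -> logw (g x) = logw x.
Proof. by elim=> //= b {}g bP _ <-; rewrite logw_refl. Qed.

Lemma wall_pos_neq0 x a : wall_pos x -> a \in Phi -> kap a != 0 -> dot a x != 0.
Proof.
by move=> hx aP ka; apply/eqP => ax; have := hx a aP ka; rewrite ax mul0r ltxx.
Qed.

Lemma logwZ x t : 0 < t -> wall_pos x -> logw (t *: x) = g0 * ln t + logw x.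
Proof.
move=> t0 hx; rewrite /logw /g0 /gam mulr_suml -big_split /= big_seq [RHS]big_seq.
apply: eq_bigr => a aP; have [->|ka] := eqVneq (kap a) 0; first by ring.
have ax : 0 < dot a x ^+ 2 by rewrite exprn_even_gt0 //= (wall_pos_neq0 hx).
rewrite dotZr exprMn lnM ?posrE ?ax ?exprn_gt0 // lnXn // -mulr_natr.
by field.
Qed.

Lemma nkernel_sym x y : nkernel x y = nkernel y x.
Proof.
rewrite /nkernel (kernel_sym hPhi hspan kap_ge0 kap_refl he e0 x).
by rewrite (dotC x) (addrC (logw x)).
Qed.

Lemma nkernelZ x y t : 0 < t -> wall_pos x -> wall_pos y ->
  nkernel (t *: x) y = nkernel x (t *: y).
Proof.
move=> t0 hx hy; rewrite /nkernel !logwZ // dotZl dotZr.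
rewrite (kernel_scale hPhi hspan kap_ge0 kap_refl he e0) ?(ltW t0) //.
by congr (expR _ * _); ring.
Qed.

Lemma is_derive_big (I : eqType) (r : seq I) (f : I -> R -> R) (df : I -> R) t :
  (forall i, i \in r -> is_derive t 1 (f i) (df i)) ->
  is_derive t 1 (fun s => \sum_(i <- r) f i s) (\sum_(i <- r) df i).
Proof.
elim: r => [|i r IH] h.
  by rewrite big_nil; under eq_fun do rewrite big_nil; exact: is_derive_cst.
rewrite big_cons; under eq_fun do rewrite big_cons.
apply: is_deriveD; first by apply: h; rewrite inE eqxx.
by apply: IH => j jr; apply: h; rewrite inE jr orbT.
Qed.

Lemma is_derive_line a x xi t :
  is_derive t 1 (fun s => dot a (x + s *: xi)) (dot a xi).
Proof.
have -> : (fun s => dot a (x + s *: xi)) = (fun s => dot a x + s * dot a xi).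
  by apply/funext => s; rewrite dotDr dotZr.
by apply: is_derive_eq (is_deriveD (is_derive_cst (dot a x) t 1)
  (is_derive_prod (is_derive_id t 1) (is_derive_cst (dot a xi) t 1))) _; rewrite /cst; ring.
Qed.

Lemma logw_derive x xi t : wall_pos (x + t *: xi) ->
  is_derive t 1 (fun s => logw (x + s *: xi))
    (\sum_(a <- Phi) kap a * (dot a xi / dot a (x + t *: xi))).
Proof.
move=> hx; apply: is_derive_big => a aP.
have [->|ka] := eqVneq (kap a) 0.
  under eq_fun do rewrite !mul0r.
  by rewrite mul0r; exact: is_derive_cst.
have ax := wall_pos_neq0 hx aP ka.
have d1 := is_derive_line a x xi t.
have ax2 : 0 < dot a (x + t *: xi) ^+ 2 by rewrite exprn_even_gt0.
have d2 := @is_derive1_comp R (@ln R) (fun s => dot a (x + s *: xi) ^+ 2) t _ _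
  (is_derive1_ln ax2) (is_derive_prod d1 d1).
have d3 := is_derive_prod (is_derive_cst (kap a / 2) t 1) d2.
by apply: is_derive_eq d3 _; rewrite /cst; field.
Qed.

(** Multiplying by the square root of the weight cancels the terms of the Dunkl
    operator that carry [e] at the point itself, and the exponential cancels
    the eigenvalue.  What remains is a sum of the values at the reflected points
    with nonnegative coefficients. *)
Lemma nkernel_mono x y xi : wall_pos x ->
  (forall a, a \in Phi -> kap a != 0 -> 0 <= dot a xi * dot a p) ->
  nkernel x y <= nkernel (x + xi) y.
Proof.
move=> hx hxi.
have hxt t : 0 <= t -> wall_pos (x + t *: xi).
  move=> t0 a aP ka; rewrite dotDr dotZr mulrDl ltr_pwDl ?hx //.
  by rewrite -mulrA mulr_ge0 // hxi.
pose S t := \sum_(a <- Phi) kap a * (dot a xi / dot a (x + t *: xi)) *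
  e (refl a (x + t *: xi)) y.
have := @is_derive_nondecr R (fun t => nkernel (x + t *: xi) y)
  (fun t => expR (logw (x + t *: xi) + logw y - dot (x + t *: xi) y) * S t)
  0 1 ler01.
rewrite scale0r addr0 scale1r; apply => t /andP[t0 _].
- have d1 := logw_derive (hxt t t0).
  have d2 := is_derive_line y x xi t.
  have d3 : is_derive t 1 (fun s => logw (x + s *: xi) + logw y - dot y (x + s *: xi)) _
    := is_deriveB (is_deriveD d1 (is_derive_cst (logw y) t 1)) d2.
  have d4 := is_derive_prod (is_derive_exp d3) (eigen_line (he y) x xi t).
  rewrite /nkernel; under eq_fun do rewrite (dotC (x + _)).
  apply: is_derive_eq d4 _.
  rewrite (eigen_dir (he y)); last first.
    by move=> a aP ka; apply: wall_pos_neq0 (hxt t t0) aP ka.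
  rewrite /cst /= (dotC (x + _) y) /S.
  set D := \sum_(a <- Phi) kap a * _.
  have -> : \sum_(a <- Phi) kap a * (dot a xi / dot a (x + t *: xi)) *
      (e (x + t *: xi) y - e (refl a (x + t *: xi)) y) = D * e (x + t *: xi) y -
      \sum_(a <- Phi) kap a * (dot a xi / dot a (x + t *: xi)) *
        e (refl a (x + t *: xi)) y.
    by rewrite mulr_suml -sumrB; apply: eq_bigr => a _; rewrite mulrBr.
  ring.
- rewrite mulr_ge0 ?expR_ge0 // /S big_seq; apply: sumr_ge0 => a aP.
  have [->|ka] := eqVneq (kap a) 0; first by rewrite !mul0r.
  apply: mulr_ge0 => //; apply: mulr_ge0; first exact: kap_ge0.
  have ap2 : 0 < (dot a (x + t *: xi) * dot a p) ^+ 2.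
    by rewrite exprn_gt0 // hxt.
  have ax := wall_pos_neq0 (hxt t t0) aP ka.
  have ap : dot a p != 0 := hp aP.
  have -> : dot a xi / dot a (x + t *: xi) = (dot a xi * dot a p) *
      (dot a (x + t *: xi) * dot a p) / (dot a (x + t *: xi) * dot a p) ^+ 2.
    by field; rewrite ?ax ?ap.
  by rewrite divr_ge0 ?(ltW ap2) // mulr_ge0 ?hxi // ltW // hxt.
Qed.

(** The normalized kernel along a ray, with the power [t ^ gam] of the weight
    made explicit and constants [w] and [m] for the other exponents. *)
Definition ray_nkernel y w m t z := expR (g0 * ln t + w - t * m) * e (t *: z) y.
Definition ray_nkernel' y w m t z := (- (m - dot y z)) * ray_nkernel y w m t z +
  (\sum_(a <- Phi) kap a * ray_nkernel y w m t (refl a z)) / t.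

Lemma ray_nkernel_ge0 y w m t z : 0 <= ray_nkernel y w m t z.
Proof. by rewrite mulr_ge0 ?expR_ge0. Qed.

Lemma ray_nkernel_derive y w m t z : 0 < t ->
  is_derive t 1 (ray_nkernel y w m ^~ z) (ray_nkernel' y w m t z).
Proof.
move=> t0.
have d1 := is_derive_prod (is_derive_cst g0 t 1) (is_derive1_ln t0).
have d2 := is_derive_prod (is_derive_id t 1) (is_derive_cst m t 1).
have d3 : is_derive t 1 (fun s => g0 * ln s + w - s * m) _
  := is_deriveB (is_deriveD d1 (is_derive_cst w t 1)) d2.
have d4 := is_derive_prod (is_derive_exp d3) (eigen_ray z t (he y)).
apply: is_derive_eq d4 _.
have tn : t != 0 by rewrite gt_eqF.
have rad := eigen_rad (he y) z t.
have -> : 'D_z (e^~ y) (t *: z) = (t * 'D_z (e^~ y) (t *: z)) / t by field.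
rewrite rad /ray_nkernel' /ray_nkernel.
have -> : \sum_(a <- Phi) kap a * (expR (g0 * ln t + w - t * m) * e (t *: refl a z) y)
  = expR (g0 * ln t + w - t * m) * \sum_(a <- Phi) kap a * e (t *: refl a z) y.
  by rewrite mulr_sumr; apply: eq_bigr => a _; rewrite mulrCA.
by rewrite -/g0 /cst /=; field.
Qed.

Lemma ray_nkernel_ode y w m t z : t != 0 -> t * ray_nkernel' y w m t z =
  - (t * (m - dot y z)) * ray_nkernel y w m t z +
  \sum_(a <- Phi) kap a * ray_nkernel y w m t (refl a z).
Proof. by move=> t0; rewrite /ray_nkernel'; field. Qed.

Lemma ray_nkernel_ratio x y w m z t : 0 < t -> wall_pos x ->
  ray_nkernel x (logw x + w) m t z = expR (logw (t *: x) + w - t * m) * e z (t *: x).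
Proof.
move=> t0 hx; rewrite /ray_nkernel logwZ //.
by rewrite (kernel_scale hPhi hspan kap_ge0 kap_refl he e0) ?ltW // addrA.
Qed.

Lemma wall_pos_p : wall_pos p.
Proof.
by move=> a aP _; rewrite -expr2 exprn_even_gt0 //=; apply: hp.
Qed.

Lemma wall_posZ x t : 0 < t -> wall_pos x -> wall_pos (t *: x).
Proof.
by move=> t0 hx a aP ka; rewrite dotZr -mulrA mulr_gt0 // hx.
Qed.

Lemma refl_neq a : a \in Phi -> refl a p != p.
Proof.
move=> aP; rewrite /refl subr_eq addrC -subr_eq subrr eq_sym scaler_eq0.
rewrite (negPf (root_neq0 hPhi aP)) orbF !mulf_neq0 ?invr_neq0 //; first exact: hp.
by rewrite dot_eq0 (root_neq0 hPhi aP).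
Qed.

(** On the ray through [p] the point [p] is the strict maximum of [<p, .>] on
    its orbit, so that the other components decay at a uniform rate and the
    function [c / t] on them, with [1 - b / t] at [p], is a supersolution. *)
Lemma ray_bound : exists c t0, 0 < t0 /\ forall t, t0 <= t -> nkernel (t *: p) p <= c.
Proof.
have [orb [orbP pO hO]] := orbit_exists hPhi hspan p.
have norm z : z \in orb -> dot z z = dot p p.
  by move=> /hO[g gG ->]; apply: group_norm gG.
have [d d0 hd] : exists2 d, 0 < d &
    forall z, z \in orb -> z != p -> d <= dot p p - dot p z.
  pose others := [seq z <- orb | z != p].
  have mem z : z \in orb -> z != p -> z \in others.
    by move=> zO zp; rewrite mem_filter zp.
  case E : others => [|z0 l].
    by exists 1 => // z zO zp; have := mem z zO zp; rewrite E.
  have z0O : z0 \in others by rewrite E inE eqxx.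
  have [v + hv] := exists_max (dot p) z0O.
  rewrite mem_filter => /andP[vp vO]; exists (dot p p - dot p v).
    by rewrite subr_gt0 dot_lt_eqnorm ?norm // eq_sym.
  by move=> z zO zp; rewrite lerD2l lerN2 hv // mem.
have Dge0 z : z \in orb -> 0 <= dot p p - dot p z.
  by move=> zO; have [->|/(hd z zO)] := eqVneq z p; [rewrite subrr|lra].
(* [b] balances the gain of the component at [p] from its neighbours, and [c]
   makes the decay of the others exceed what they receive. *)
pose c := (g0 + 1) / d; pose b := g0 * c.
have c0 : 0 < c by rewrite divr_gt0 // ltr_wpDl.
have b0 : 0 <= b by rewrite mulr_ge0 // ltW.
have dc : d * c = g0 + 1 by rewrite mulrC divfK // gt_eqF.
pose t0 := c + 2 * b.
have t00 : 0 < t0 by rewrite /t0; lra.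
pose w := logw p + logw p; pose m := dot p p.
pose h := ray_nkernel p w m; pose h' := ray_nkernel' p w m.
pose mu := Num.min 2^-1 (c / t0).
have mu0 : 0 < mu by rewrite lt_min invr_gt0 ltr0n divr_gt0.
have [v vO hv] := exists_max (h t0) pO.
pose A := h t0 v / mu.
have A0 : 0 <= A by rewrite divr_ge0 ?ray_nkernel_ge0 // ltW.
pose U t z := if z == p then A * (1 - b / t) else A * (c / t).
pose U' t z := if z == p then A * (b / t ^+ 2) else - (A * (c / t ^+ 2)).
have dinv q s : 0 < s -> is_derive s 1 (fun t => q / t) (- (q / s ^+ 2)).
  move=> s0; have sn : s != 0 by rewrite gt_eqF.
  have := is_derive_prod (is_derive_cst q s 1) (is_deriveV sn (is_derive_id s 1)).
  by move=> H; apply: is_derive_eq H _; rewrite /cst /GRing.scale /=; field.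
have dU z s : 0 < s -> is_derive s 1 (U ^~ z) (U' s z).
  move=> s0; rewrite /U /U'; case: (z == p).
    have := is_derive_prod (is_derive_cst A s 1)
      (is_deriveB (is_derive_cst (1 : R) s 1) (dinv b s s0)).
    by move=> H; apply: is_derive_eq H _; rewrite /cst; ring.
  have := is_derive_prod (is_derive_cst A s 1) (dinv c s s0).
  by move=> H; apply: is_derive_eq H _; rewrite /cst; ring.
have tle s : t0 <= s -> [/\ 0 < s, c / s <= 1 & b / s <= 2^-1].
  move=> s1; have s0 : 0 < s by apply: lt_le_trans s1.
  have t0E : t0 = c + 2 * b by [].
  by split=> //; rewrite ler_pdivrMr //; lra.
have UA s z : t0 <= s -> U s z <= A.
  move=> /tle[s0 cs bs]; rewrite /U; case: (z == p).
    by rewrite ler_piMr // gerBl divr_ge0 // ltW.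
  by rewrite ler_piMr.
have main t : t0 <= t -> h t p <= U t p.
  move=> t0t; rewrite -subr_ge0.
  apply: (max_principle kap_ge0 (orb := orb) (t0 := t0) (T := t) (K := g0 / t0)
    (F := fun s z => U s z - h s z) (F' := fun s z => U' s z - h' s z)
    (b := fun s z => - (s * (m - dot p z)))) => //.
  - exact: ltW.
  - move=> z s zO /andP[/tle[s0 _ _] _]; apply: is_deriveB (dU z s s0) _.
    exact: ray_nkernel_derive.
  - move=> z s zO /andP[/ltW s1 _] _; have [s0 cs bs] := tle s s1.
    have sn : s != 0 by rewrite gt_eqF.
    rewrite [leRHS]mulrBr /h' ray_nkernel_ode // -/h.
    under eq_bigr do rewrite mulrBr; rewrite sumrB.
    suff : - (s * (m - dot p z)) * U s z + \sum_(a <- Phi) kap a * U s (refl a z)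
        <= s * U' s z by rewrite /m; lra.
    have [zp|zp] := eqVneq z p.
      have -> : \sum_(a <- Phi) kap a * U s (refl a z) = g0 * (A * (c / s)).
        rewrite /g0 /gam mulr_suml big_seq [RHS]big_seq; apply: eq_bigr => a aP.
        by rewrite zp /U (negPf (refl_neq aP)).
      rewrite zp /m subrr mulr0 oppr0 mul0r add0r /U' eqxx.
      have -> : s * (A * (b / s ^+ 2)) = g0 * (A * (c / s)) by rewrite /b; field.
      exact: lexx.
    have sumA : \sum_(a <- Phi) kap a * U s (refl a z) <= g0 * A.
      rewrite /g0 /gam mulr_suml big_seq [leRHS]big_seq; apply: ler_sum => a aP.
      by rewrite ler_wpM2l ?kap_ge0 ?UA.
    have DA : g0 * A + A * (c / s) <= s * (m - dot p z) * U s z.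
      rewrite /U (negPf zp).
      have -> : s * (m - dot p z) * (A * (c / s)) = A * ((m - dot p z) * c) by field.
      have -> : g0 * A + A * (c / s) = A * (g0 + c / s) by ring.
      rewrite ler_wpM2l //; apply: le_trans (_ : d * c <= _); first by rewrite dc; lra.
      by rewrite ler_wpM2r ?hd // ltW.
    have -> : s * U' s z = - (A * (c / s)) by rewrite /U' (negPf zp); field.
    lra.
  - move=> z s zO /andP[s1 _]; rewrite -/g0.
    have s0 : 0 < s by apply: lt_trans s1.
    apply: le_trans (_ : g0 <= _).
      by rewrite gerDr oppr_le0 mulr_ge0 ?Dge0 // ltW.
    by rewrite mulrAC -mulrA ler_peMr // ler_pdivlMr // mul1r ltW.
  - move=> z zO; rewrite subr_ge0; apply: le_trans (hv z zO) _.
    have -> : h t0 v = A * mu by rewrite /A divfK // gt_eqF.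
    have [_ cs bs] := tle t0 (lexx _).
    rewrite /U; case: (z == p); rewrite ler_wpM2l // /mu ge_min.
      by apply/orP; left; lra.
    by rewrite lexx orbT.
  - by rewrite t0t lexx.
exists A, t0; split=> // t t0t; apply: le_trans (UA t p t0t).
have [s0 _ _] := tle t t0t.
apply: le_trans (main t t0t).
rewrite /h /ray_nkernel /nkernel logwZ //; last exact: wall_pos_p.
by rewrite dotZl -/m -[X in expR (X - _)]addrA.
Qed.

(** [nkernel] increases in both arguments in the directions of the chamber, and a
    far point of the ray through [p] exceeds any given point by such a
    direction; hence the ray controls the whole chamber. *)
Lemma wall_pos_bound : exists c, forall x y, wall_pos x -> wall_pos y -> nkernel x y <= c.
Proof.
have [c [t0 [t00 hc]]] := ray_bound.
exists c => x y hx hy.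
pose T := 1 + t0 + \sum_(a <- Phi) (`|dot a x / dot a p| + `|dot a y / dot a p|).
have T1 : 1 + t0 <= T by rewrite lerDl sumr_ge0 // => a _; rewrite addr_ge0.
have T0 : 0 < T by lra.
have ab a : a \in Phi -> `|dot a x / dot a p| <= T /\ `|dot a y / dot a p| <= T.
  move=> aP.
  have : `|dot a x / dot a p| + `|dot a y / dot a p| <= T.
    rewrite /T (bigD1_seq a) ?fset_uniq //= addrCA lerDl !addr_ge0 ?(ltW t00) //.
    by rewrite sumr_ge0 // => i _; rewrite addr_ge0.
  by move=> H; split; apply: le_trans H; rewrite ?lerDl ?lerDr.
have dir u : (forall a, a \in Phi -> `|dot a u / dot a p| <= T) ->
    forall a, a \in Phi -> kap a != 0 -> 0 <= dot a (T *: p - u) * dot a p.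
  move=> hu a aP _; have ap : dot a p != 0 := hp aP.
  have ap2 : 0 < dot a p ^+ 2 by rewrite exprn_even_gt0.
  have := hu a aP; rewrite ler_norml => /andP[_ H].
  have -> : dot a (T *: p - u) * dot a p = (T - dot a u / dot a p) * dot a p ^+ 2.
    by rewrite dotBr dotZr; field.
  by rewrite mulr_ge0 ?(ltW ap2) // subr_ge0.
have hT : wall_pos (T *: p) := wall_posZ T0 wall_pos_p.
have step u z : wall_pos u -> (forall a, a \in Phi -> `|dot a u / dot a p| <= T) ->
    nkernel u z <= nkernel (T *: p) z.
  move=> hu huT; have := nkernel_mono z hu (dir u huT).
  by rewrite addrC subrK.
apply: le_trans (step x y hx (fun a aP => (ab a aP).1)) _.
rewrite nkernel_sym; apply: le_trans (step y _ hy (fun a aP => (ab a aP).2)) _.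
rewrite -nkernelZ // ?scalerA; [|exact: wall_pos_p].
apply: hc; apply: le_trans (_ : T <= _); first lra.
by rewrite ler_peMl ?ltW //; lra.
Qed.


(** Along a ray the component at [z] feeds the one at [refl a z] at the rate
    [kap a / t], and a loss of at most [K] limits the decay of both between the
    times 1 and 2. *)
Lemma harnack_step y w m K z a : a \in Phi -> kap a != 0 ->
  m - dot y z <= K -> 0 <= m - dot y (refl a z) <= K ->
  ray_nkernel y w m 1 z <= 2 / kap a * expR (3 * K) * ray_nkernel y w m 2 (refl a z).
Proof.
move=> aP ka zK /andP[z'0 z'K].
set z' := refl a z in z'0 z'K *.
have K0 : 0 <= K by apply: le_trans z'K.
have ka0 : 0 < kap a by rewrite lt_neqAle eq_sym ka kap_ge0.
pose h := ray_nkernel y w m; pose D v := m - dot y v.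
have h0 t v : 0 <= h t v by exact: ray_nkernel_ge0.
have dE v t : 0 < t -> is_derive t 1 (fun s => expR (s * D v) * h s v)
    (expR (t * D v) * ((\sum_(b <- Phi) kap b * h t (refl b v)) / t)).
  move=> t0.
  have d1 := is_derive_prod (is_derive_id t 1) (is_derive_cst (D v) t 1).
  have d2 := is_derive_prod (is_derive_exp d1) (ray_nkernel_derive y w m v t0).
  by apply: is_derive_eq d2 _; rewrite /ray_nkernel' /h /D /cst; field; rewrite gt_eqF.
have kh_ge0 t b v : b \in Phi -> 0 <= kap b * h t v.
  by move=> bP; rewrite mulr_ge0 ?kap_ge0.
have sum_ge0 v t : 0 <= \sum_(b <- Phi) kap b * h t (refl b v).
  by rewrite big_seq; apply: sumr_ge0 => b bP; rewrite kh_ge0.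
have inc t : 1 <= t <= 2 -> expR (- K) * h 1 z <= h t z.
  move=> /andP[t1 t2].
  have : expR (1 * D z) * h 1 z <= expR (t * D z) * h t z.
    have dEz s : 1 <= s <= t -> is_derive s 1 (fun s => expR (s * D z) * h s z)
        (expR (s * D z) * ((\sum_(b <- Phi) kap b * h s (refl b z)) / s)).
      by move=> /andP[s1 _]; apply: dE; lra.
    apply: (is_derive_nondecr t1 dEz) => s /andP[s1 _].
    by rewrite mulr_ge0 ?expR_ge0 // divr_ge0 ?sum_ge0 //; lra.
  rewrite -ler_pdivlMl ?expR_gt0 // -expRN mulrA -expRD => H.
  rewrite expRN ler_pdivrMl ?expR_gt0 //; apply: le_trans H _.
  rewrite ler_wpM2r // ler_expR mul1r.
  have : (t - 1) * D z <= (t - 1) * K by rewrite ler_wpM2l // subr_ge0.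
  have : (t - 1) * K <= 1 * K by rewrite ler_wpM2r //; lra.
  lra.
pose q := kap a / 2 * (expR (- K) * h 1 z).
have q0 : 0 <= q by rewrite !mulr_ge0 ?expR_ge0 ?invr_ge0 // ltW.
have dG t : 1 <= t <= 2 -> is_derive t 1 (fun s => expR (s * D z') * h s z' - s * q)
    (expR (t * D z') * ((\sum_(b <- Phi) kap b * h t (refl b z')) / t) - q).
  move=> /andP[t1 _].
  have d1 := is_derive_prod (is_derive_id t 1) (is_derive_cst q t 1).
  have t0 : 0 < t by lra.
  by apply: is_derive_eq (is_deriveB (dE z' t t0) d1) _; rewrite /cst; ring.
have q2 : q <= expR (2 * D z') * h 2 z'.
  have : expR (1 * D z') * h 1 z' - 1 * q <= expR (2 * D z') * h 2 z' - 2 * q.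
    apply: (is_derive_nondecr (ler1n R 2) dG) => t ht; case/andP: (ht) => t1 t2.
    have t0 : 0 < t by lra.
    rewrite subr_ge0.
    apply: le_trans (_ : (\sum_(b <- Phi) kap b * h t (refl b z')) / t <= _).
      rewrite ler_pdivlMr //; apply: le_trans (_ : kap a * h t z <= _).
        apply: le_trans (_ : kap a * (expR (- K) * h 1 z) <= _); last first.
          by rewrite ler_pM2l // inc.
        have -> : kap a * (expR (- K) * h 1 z) = q * 2 by rewrite /q; field.
        by rewrite ler_wpM2l.
      rewrite (bigD1_seq a) ?fset_uniq //= reflK lerDl.
      by rewrite big_seq_cond; apply: sumr_ge0 => b /andP[bP _]; rewrite kh_ge0.
    rewrite ler_peMl ?divr_ge0 ?(ltW t0) // -[leLHS]expR0 ler_expR.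
    by rewrite mulr_ge0 // ltW.
  have : 0 <= expR (1 * D z') * h 1 z' by rewrite mulr_ge0 ?expR_ge0.
  lra.
have -> : ray_nkernel y w m 1 z = 2 / kap a * expR K * q.
  have EK : expR K * expR (- K) = 1 by rewrite -expRD subrr expR0.
  rewrite /q /h; set X := ray_nkernel y w m 1 z.
  have {1}-> : X = expR K * expR (- K) * X by rewrite EK mul1r.
  by field.
rewrite -!mulrA ler_wpM2l // ler_wpM2l ?invr_ge0 ?(ltW ka0) //.
have -> : expR (3 * K) = expR K * expR (2 * K) by rewrite -expRD; congr expR; ring.
rewrite -mulrA ler_wpM2l ?expR_ge0 //; apply: le_trans q2 _.
by rewrite ler_wpM2r // ler_expR ler_wpM2l.
Qed.

(** The kernel at a point [z] of the orbit of [y], normalized as at [y]. *)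
Definition orbit_nkernel x y z := expR (logw x + logw y - dot x y) * e z x.

Lemma chamber_wall_pos x : chamber (Phi := Phi) p x -> wall_pos x.
Proof. by move=> hx a aP _; apply: hx. Qed.

Lemma chamberZ x t : 0 < t -> chamber (Phi := Phi) p x -> chamber (Phi := Phi) p (t *: x).
Proof. by move=> t0 hx a aP; rewrite dotZr -mulrA mulr_gt0 // hx. Qed.

Lemma chamber_regular x : chamber (Phi := Phi) p x -> regular_set Phi x.
Proof.
by move=> hx a aP /=; apply/eqP => ax; have := hx a aP; rewrite ax mul0r ltxx.
Qed.

Lemma ray_nkernel_orbit_nkernel x y z t : 0 < t -> chamber (Phi := Phi) p x ->
  ray_nkernel x (logw x + logw y) (dot x y) t z = orbit_nkernel (t *: x) y z.
Proof.
move=> t0 hx; rewrite ray_nkernel_ratio //; last exact: chamber_wall_pos.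
by rewrite /orbit_nkernel dotZl.
Qed.

(** As long as a point of the orbit violates a wall of positive multiplicity,
    [harnack_step] compares it with its mirror image, which has a larger product
    with [x]; the number of such steps is bounded by the size of the orbit.  Each
    step doubles [x], hence also the admissible loss [K]. *)
Lemma chain_bound (N : nat) K : 0 <= K -> exists c,
  forall x y orb z, chamber (Phi := Phi) p x -> chamber (Phi := Phi) p y ->
  (forall z, z \in orb <-> exists2 g, refl_group Phi g & z = g y) ->
  z \in orb -> dot x y - dot x z <= K ->
  (count (fun z' => dot x z < dot x z')%R orb < N)%N ->
  orbit_nkernel x y z <= c.
Proof.
elim: N K => [|N IH] K K0; first by exists 0.
have [c0 hc0] := wall_pos_bound.
have [|c1 hc1] := IH (2 * K); first by rewrite mulr_ge0.
pose C := \sum_(a <- Phi) 2 / kap a * expR (3 * K).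
have term_ge0 a : a \in Phi -> 0 <= 2 / kap a * expR (3 * K).
  by move=> aP; rewrite mulr_ge0 ?expR_ge0 // divr_ge0 ?kap_ge0.
exists (`|c0| + C * `|c1|) => x y orb z hx hy hO zO zK zN.
have C0 : 0 <= C by rewrite /C big_seq; apply: sumr_ge0.
have [g gG zE] : exists2 g, refl_group Phi g & z = g y by apply/hO.
have max v : v \in orb -> dot x v <= dot x y.
  by move=> /hO[f fG ->]; apply: (chamber_max hPhi hspan hp).
have reg := group_regular hPhi gG (chamber_regular hy); rewrite -zE in reg.
have [[a [aP ka neg]]|no] :=
    pselect (exists a, [/\ a \in Phi, kap a != 0 & dot a z * dot a p < 0]).
  have z'O : refl a z \in orb := orbit_refl aP hO zO.
  have zz' : dot x z < dot x (refl a z).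
    rewrite dot_reflE ltrDl oppr_gt0.
    have ax := hx a aP.
    have ap2 : 0 < dot a p ^+ 2 by rewrite exprn_even_gt0 //=; apply: hp.
    have a0 : 0 < (dot a a)^-1 by rewrite invr_gt0 dot_gt0 (root_neq0 hPhi).
    have -> : 2 * dot a z / dot a a * dot a x =
        2 * (dot a a)^-1 * (dot a z * dot a x) by ring.
    rewrite pmulr_rlt0 ?mulr_gt0 // -(pmulr_rlt0 _ ap2).
    have -> : dot a p ^+ 2 * (dot a z * dot a x) =
        (dot a z * dot a p) * (dot a x * dot a p) by ring.
    by rewrite nmulr_rlt0.
  have z'y := max _ z'O.
  have := @harnack_step x (logw x + logw y) (dot x y) K z a aP ka zK _.
  rewrite !ray_nkernel_orbit_nkernel // scale1r => H; apply: le_trans (H _) _.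
    by apply/andP; split; lra.
  apply: le_trans (_ : C * `|c1| <= _); last by rewrite lerDr.
  apply: ler_pM; first exact: term_ge0.
  - by rewrite mulr_ge0 ?expR_ge0.
  - rewrite /C (bigD1_seq a) ?fset_uniq //= lerDl big_seq_cond.
    by apply: sumr_ge0 => b /andP[bP _]; apply: term_ge0.
  - apply: le_trans (ler_norm c1).
    apply: (hc1 _ _ orb) => //; first exact: chamberZ.
      by rewrite !dotZl; lra.
    rewrite -ltnS; apply: leq_trans zN; rewrite ltnS.
    apply: (@count_lt _ _ _ _ (refl a z)) => //=.
      by move=> v /=; rewrite !dotZl ltr_pM2l //; apply: lt_trans.
    by rewrite ltxx.
have zw : wall_pos z.
  move=> a aP ka; rewrite lt_neqAle eq_sym mulf_neq0 ?reg //=; last exact: hp.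
  by rewrite leNgt; apply/negP => neg; apply: no; exists a.
apply: le_trans (_ : c0 <= _); last first.
  by apply: le_trans (ler_norm c0) _; rewrite lerDl mulr_ge0.
apply: le_trans (hc0 z x zw (chamber_wall_pos hx)).
rewrite /orbit_nkernel /nkernel ler_wpM2r // ler_expR (dotC z x) zE logw_group // -zE.
have := max z zO; lra.
Qed.

(** At a maximum over time and orbit of the normalized kernel the decay rate
    [t * <x, y - z>] is at most [gam], so that [chain_bound] applies there.  In
    terms of [max_principle], the constant bound is a supersolution wherever it
    fails. *)
Lemma orbit_bound : 0 < g0 -> exists2 c, 0 < c & forall x y g,
  chamber (Phi := Phi) p x -> chamber (Phi := Phi) p y -> refl_group Phi g ->
  orbit_nkernel x y (g y) <= c.
Proof.
move=> gpos.
have [N hN] := orbit_seq hPhi hspan.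
have [c1 hc1] := chain_bound N.+1 g0_ge0.
pose c := Num.max c1 1.
have c0 : 0 < c by rewrite lt_max ltr01 orbT.
exists c => // x y g hx hy gG.
have [orb [szO hO]] := hN y.
have orbP : closed_orb (Phi := Phi) orb by move=> a v aP; apply: orbit_refl aP hO.
have zO : g y \in orb by apply/hO; exists g.
have max v : v \in orb -> dot x v <= dot x y.
  by move=> /hO[f fG ->]; apply: (chamber_max hPhi hspan hp).
pose w := logw x + logw y; pose m := dot x y.
pose h := ray_nkernel x w m.
have hc t z : 0 < t -> z \in orb -> t * (m - dot x z) <= g0 -> h t z <= c.
  move=> t0 zorb tD; rewrite /h ray_nkernel_orbit_nkernel // le_max; apply/orP; left.
  apply: (hc1 _ _ orb) => //; first exact: chamberZ.
    by rewrite !dotZl -mulrBr.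
  by rewrite ltnS; apply: leq_trans (count_size _ _) szO.
(* At this time the power [t ^ gam] compensates for the constant [exp w]. *)
pose t1 := expR (- `|w| / g0).
have t10 : 0 < t1 by exact: expR_gt0.
have t11 : t1 <= 1.
  by rewrite -[leRHS]expR0 ler_expR pmulr_lle0 ?invr_gt0 // oppr_le0.
suff : 0 <= c - h 1 (g y) by rewrite subr_ge0 /h ray_nkernel_orbit_nkernel // scale1r.
apply: (max_principle kap_ge0 (orb := orb) (t0 := t1) (T := 1) (K := g0 / t1)
    (F := fun s z => c - h s z) (F' := fun s z => - ray_nkernel' x w m s z)
    (b := fun s z => - (s * (m - dot x z)))) => //.
- exact: ltW.
- move=> z t _ /andP[tt1 _]; have t0 : 0 < t by apply: lt_le_trans tt1.
  have := is_deriveB (is_derive_cst c t 1) (ray_nkernel_derive x w m z t0).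
  by move=> H; apply: is_derive_eq H _; rewrite sub0r.
- move=> z t zorb /andP[tt1 _] Fneg; have t0 : 0 < t by apply: lt_trans tt1.
  have tD : g0 < t * (m - dot x z).
    rewrite ltNge; apply/negP => /(hc t z t0 zorb); rewrite -subr_ge0 leNgt.
    by rewrite Fneg.
  rewrite mulrN ray_nkernel_ode ?gt_eqF // -/h.
  under eq_bigr do rewrite mulrBr; rewrite sumrB -mulr_suml -/(gam _) -/g0.
  have : g0 * c <= t * (m - dot x z) * c by rewrite ler_wpM2r // ltW.
  lra.
- move=> z t zorb /andP[tt1 _]; rewrite -/(gam _) -/g0.
  have t0 : 0 < t by apply: lt_trans tt1.
  apply: le_trans (_ : g0 <= _).
    by rewrite gerDr oppr_le0 mulr_ge0 ?subr_ge0 ?max // ltW.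
  by rewrite mulrAC -mulrA ler_peMr // ler_pdivlMr // mul1r ltW.
- move=> z zorb; rewrite subr_ge0.
  apply: le_trans (_ : 1 <= _); last by rewrite le_max lexx orbT.
  rewrite /h /ray_nkernel -[leRHS]expR0.
  have := kernel_le_exp kap_ge0 he e0 orbP zorb (ltW t10) max => H.
  apply: le_trans (ler_wpM2l (expR_ge0 _) H) _.
  rewrite -expRD ler_expR /t1 expRK mulrCA divff ?gt_eqF // mulr1 -/m.
  have := ler_norm w; lra.
- by rewrite t11 lexx.
Qed.

End Bound.

(** * The Dunkl kernel *)

Section DunklOperator.
Context {R : realType} {n : nat} {Phi Phip : {fset 'rV[R]_n}}.
Variable k : 'rV[R]_n -> R.
Hypotheses (hPhi : reduced_root_system Phi) (hPhip : positive_subsystem Phi Phip).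
Hypothesis hk : multiplicity_function Phi k.
Implicit Types (x y z xi a b : 'rV[R]_n) (f : 'rV[R]_n -> R) (t : R).

Let kap a := k a / 2.

Lemma mult_refl a b : a \in Phi -> b \in Phi -> k (refl b a) = k a.
Proof.
move=> aP bP.
exact: (mult_inv hk (refl_group_comp bP (refl_group_id Phi)) aP).
Qed.

Lemma mult_opp a : a \in Phi -> k (- a) = k a.
Proof. by move=> aP; rewrite -(refl_self (root_neq0 hPhi aP)) mult_refl. Qed.

Lemma half_mult_ge0 a : a \in Phi -> 0 <= kap a.
Proof. by move=> aP; rewrite divr_ge0 // (mult_ge0 hk). Qed.

Lemma half_mult_refl a b : a \in Phi -> b \in Phi -> kap (refl b a) = kap a.
Proof. by move=> aP bP; rewrite /kap mult_refl. Qed.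

Lemma posroot_mem a : a \in Phip -> a \in Phi.
Proof. by case: hPhip => b _ ->; rewrite !inE => /andP[]. Qed.

Lemma is_derive_along f x xi t : derivable f (x + t *: xi) xi ->
  is_derive t (1 : R) (fun s => f (x + s *: xi)) ('D_xi f (x + t *: xi)).
Proof.
move=> df.
have E : (fun h : R => h^-1 *: (((fun s => f (x + s *: xi)) \o shift t) (h *: 1)
      - f (x + t *: xi))) =
    (fun h => h^-1 *: ((f \o shift (x + t *: xi)) (h *: xi) - f (x + t *: xi))).
  apply/funext => h /=; congr (_ *: (f _ - _)).
  by rewrite (_ : h *: (1 : R) = h) ?scalerDl 1?addrCA // /GRing.scale /= mulr1.
by split; rewrite /derivable /derive E.
Qed.

Lemma dunkl_eigenfun f y : real_analytic f ->
  (forall xi x, dunkl_op Phip k xi f x = dot y xi * f x) ->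
  eigenfun (Phi := Phi) kap y f.
Proof.
move=> fan feq.
have sums (F : 'rV[R]_n -> R) : (forall a, a \in Phi -> F (- a) = F a) ->
    \sum_(a <- Phip) k a * F a = \sum_(a <- Phi) kap a * F a.
  move=> hF; rewrite (sum_root_half hPhi (F := fun a => k a * F a) hPhip).
    by apply: eq_bigr => a _; rewrite mulrAC.
  by move=> a aP; rewrite mult_opp // hF.
split.
- by move=> x xi t; apply: is_derive_along; apply: analytic_derivable.
- move=> x t; have := feq x (t *: x); rewrite /dunkl_op => /(canRL (addrK _)) ->.
  rewrite mulrBr mulr_sumr.
  have -> : \sum_(a <- Phip) t * (k a * dot a x * refl_quotient f a (t *: x))
      = \sum_(a <- Phip) k a * (f (t *: x) - f (t *: refl a x)).
    apply: eq_bigr => a _; rewrite /refl_quotient dotZr -reflZ.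
    have [t0|tn] := eqVneq (t * dot a x) 0.
      rewrite (refl_fix (_ : dot a (t *: x) = 0)) ?dotZr // subrr mulr0.
      by rewrite mulrA [t * _]mulrCA t0 mulr0 mul0r.
    by move: tn; rewrite mulf_eq0 negb_or => /andP[tn an]; field; rewrite tn an.
  rewrite (sums (fun a => f (t *: x) - f (t *: refl a x))); last first.
    by move=> a aP; rewrite refl_opp.
  under eq_bigr do rewrite mulrBr.
  rewrite sumrB -mulr_suml -/(gam (Phi := Phi) kap); ring.
- move=> x xi hx; have := feq xi x; rewrite /dunkl_op => /(canRL (addrK _)) ->.
  congr (_ - _).
  have -> : \sum_(a <- Phip) k a * dot a xi * refl_quotient f a x
      = \sum_(a <- Phip) k a * (dot a xi / dot a x * (f x - f (refl a x))).
    rewrite big_seq [RHS]big_seq; apply: eq_bigr => a /posroot_mem aP.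
    have [ka|ka] := eqVneq (k a) 0; first by rewrite ka !mul0r.
    have ax : dot a x != 0 by apply: hx => //; rewrite mulf_neq0 // invr_neq0 ?pnatr_eq0.
    by rewrite /refl_quotient (negPf ax); field.
  rewrite (sums (fun a => dot a xi / dot a x * (f x - f (refl a x)))).
    by apply: eq_bigr => a _; rewrite mulrA.
  by move=> a aP; rewrite refl_opp !dotNl invrN mulrNN.
Qed.

Lemma gammaE : gamma Phip k = gam (Phi := Phi) kap.
Proof. by rewrite /gamma (sum_root_half hPhi hPhip) // => a aP; apply: mult_opp. Qed.

Lemma weightE x : regular_set Phi x ->
  weight Phip k x = expR (2 * logw (Phi := Phi) kap x).
Proof.
move=> hx; rewrite /weight /logw.
have -> : 2 * (\sum_(a <- Phi) kap a / 2 * ln (dot a x ^+ 2)) =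
    \sum_(a <- Phip) 2 * k a * ln `|dot a x|.
  rewrite (sum_root_half hPhi (F := fun a => 2 * k a * ln `|dot a x|) hPhip).
    rewrite mulr_sumr big_seq [RHS]big_seq; apply: eq_bigr => a aP.
    have ax : 0 < `|dot a x| by rewrite normr_gt0; apply: hx.
    by rewrite -(real_normK (num_real (dot a x))) lnXn // mulr2n /kap; field.
  by move=> a aP; rewrite mult_opp // dotNl normrN.
rewrite expR_sum big_seq [RHS]big_seq; apply: eq_bigr => a /posroot_mem aP.
by rewrite /powR normr_eq0 (negPf (hx a aP)).
Qed.

End DunklOperator.

Lemma open_coneD (R : realType) (n : nat) (v : n.-tuple 'rV[R]_n) (x y : 'rV[R]_n) (s t : R) :
  0 < s -> 0 < t -> open_cone v x -> open_cone v y -> open_cone v (s *: x + t *: y).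
Proof.
move=> s0 t0 [c c0 ->] [d d0 ->].
exists (fun i => s * c i + t * d i) => [i|]; first by rewrite addr_gt0 ?mulr_gt0.
rewrite !scaler_sumr -big_split; apply: eq_bigr => i _ /=.
by rewrite !scalerA scalerDl.
Qed.

(** A convex set that misses all the reflecting hyperplanes lies on one side of
    each. *)
Lemma open_cone_chamber (R : realType) (n : nat) (Phi : {fset 'rV[R]_n})
    (v : n.-tuple 'rV[R]_n) (p x : 'rV[R]_n) :
  open_cone v `<=` regular_set Phi -> open_cone v p -> open_cone v x ->
  chamber (Phi := Phi) p x.
Proof.
move=> hreg hp hx a aP.
have ap : dot a p != 0 := hreg p hp a aP.
have ax : dot a x != 0 := hreg x hx a aP.
rewrite lt_neqAle eq_sym mulf_neq0 //= leNgt; apply/negP => neg.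
have ap0 : 0 < `|dot a p| by rewrite normr_gt0.
have ax0 : 0 < `|dot a x| by rewrite normr_gt0.
have := hreg _ (open_coneD ap0 ax0 hx hp) a aP; rewrite /= dotDr !dotZr.
move=> /eqP; apply.
case: (ltrgtP (dot a p) 0) ap => // ap _.
  have axp : 0 < dot a x by rewrite -(nmulr_llt0 _ ap).
  by rewrite (ltr0_norm ap) (gtr0_norm axp); ring.
have axn : dot a x < 0 by rewrite -(pmulr_llt0 _ ap).
by rewrite (gtr0_norm ap) (ltr0_norm axn); ring.
Qed.

Theorem theorem2p5 (R : realType) (n : nat) (Phi Phip : {fset 'rV[R]_n})
    (k : 'rV[R]_n -> R) (E : 'rV[R]_n -> 'rV[R[i]]_n -> R[i])
    (hPhi : reduced_root_system Phi)
    (hspan : spanning Phi)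
    (hPhip : positive_subsystem Phi Phip)
    (hk : multiplicity_function Phi k)
    (hgamma : 0 < gamma Phip k)
    (hE : dunkl_kernel Phip k E)
    (v : n.-tuple 'rV[R]_n)
    (hv : free v)
    (* the cone lies in a single Weyl chamber *)
    (hreg : open_cone v `<=` regular_set Phi) :
  exists2 c : R, 0 < c &
    forall (x y : 'rV[R]_n) (g : 'rV[R]_n -> 'rV[R]_n),
      open_cone v x -> open_cone v y -> refl_group Phi g ->
      E x (real_row (g y)) <=
        (c * (expR (dot x y) / Num.sqrt (weight Phip k x * weight Phip k y)))%:C.
Proof.
pose kap a := k a / 2.
have kap0 : forall a, a \in Phi -> 0 <= kap a := half_mult_ge0 hk.
have kapr : forall a b, a \in Phi -> b \in Phi -> kap (refl b a) = kap a
  := half_mult_refl hk.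
have dotC_real y xi : dot (real_row y) (real_row xi) = (dot y xi)%:C.
  by rewrite /dot rmorph_sum; apply: eq_bigr => i _; rewrite !mxE rmorphM.
pose er x y := complex.Re (E x (real_row y)).
pose ei x y := complex.Im (E x (real_row y)).
have her y : eigenfun (Phi := Phi) kap y (er ^~ y).
  apply: (dunkl_eigenfun hPhi hPhip hk); first exact: (kernel_analytic_Re hE).
  move=> xi x; have := kernel_eigen hE (real_row y) xi x; rewrite dotC_real.
  rewrite /er /dunkl_opC; case: (E x _) => r i [-> _] /=; ring.
have hei y : eigenfun (Phi := Phi) kap y (ei ^~ y).
  apply: (dunkl_eigenfun hPhi hPhip hk); first exact: (kernel_analytic_Im hE).
  move=> xi x; have := kernel_eigen hE (real_row y) xi x; rewrite dotC_real.
  rewrite /ei /dunkl_opC; case: (E x _) => r i [_ ->] /=; ring.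
have er0 y : er 0 y = 1 by rewrite /er (kernel_at0 hE).
have ei0 x y : ei x y = 0.
  by apply: (eigen0 hPhi hspan kap0 (hei y)); rewrite /ei (kernel_at0 hE).
(* Any point of the cone can serve as the base point of its chamber. *)
pose p : 'rV[R]_n := \sum_(i < n) 1 *: tnth v i.
have pc : open_cone v p by exists (fun=> 1).
have ch x : open_cone v x -> chamber (Phi := Phi) p x := open_cone_chamber hreg pc.
have g0 : 0 < gam (Phi := Phi) kap by rewrite -(gammaE hPhi hPhip hk).
have [c c0 hc] := orbit_bound hPhi hspan kap0 kapr her er0 (hreg p pc) g0.
exists c => // x y g hx hy hg.
have -> : E x (real_row (g y)) = (er x (g y))%:C.
  by have := ei0 x (g y); rewrite /er /ei; case: (E x _) => r i /= ->.
rewrite lecR; have := hc x y g (ch x hx) (ch y hy) hg.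
rewrite /orbit_nkernel (kernel_sym hPhi hspan kap0 kapr her er0 _ x) => H.
rewrite !(weightE hPhi hPhip hk) -/kap; [|exact: hreg|exact: hreg].
have -> : expR (2 * logw (Phi := Phi) kap x) * expR (2 * logw (Phi := Phi) kap y)
    = expR (logw (Phi := Phi) kap x + logw (Phi := Phi) kap y) ^+ 2.
  by rewrite -expRD expr2 -expRD; congr expR; ring.
rewrite sqrtr_sqr ger0_norm ?expR_ge0 // mulrA ler_pdivlMr ?expR_gt0 //.
move: H; rewrite expRB mulrAC ler_pdivrMr ?expR_gt0 // mulrC; apply.
Qed.
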